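(* Let $w$ be a real number such that $w>(5+\sqrt{17})/2$ if $p\neq 2$, and $w>(9+\sqrt{65})/2$ if $p=2$. Let $b,c\in\mathbb{F}_q[T]$ be distinct polynomials of degree at least one. Define $(a_{n,w})_{n\geq 1}$ by $a_{n,w}=c$ if $n=\lfloor w^i\rfloor$ for some integer $i\geq 0$, and $a_{n,w}=b$ otherwise. Put $\xi_w:=[0,a_{1,w},a_{2,w},\ldots]\in\mathbb{F}_q((T^{-1}))$. Then $w_2^{*}(\xi_w)=w-1$ and $w_2(\xi_w)=w$.
   Context: $p$ is a prime, $q$ a power of $p$, $\mathbb{F}_q$ the field with $q$ elements, and $\mathbb{F}_q((T^{-1}))$ the field of Laurent series in $T^{-1}$ over $\mathbb{F}_q$, with absolute value $|\sum_{n\ge N}a_nT^{-n}|=q^{-N}$ when $a_N\neq0$, $|0|=0$; it extends uniquely to an algebraic closure, and $\overline{\mathbb{F}_q(T)}$ denotes the algebraic closure of $\mathbb{F}_q(T)$ in it. For $P\in(\mathbb{F}_q[T])[X]$, $H(P)$ is the maximum of the absolute values of its coefficients. Each $\alpha\in\overline{\mathbb{F}_q(T)}$ has a unique minimal polynomial: the non-constant irreducible primitive $P\in(\mathbb{F}_q[T])[X]$ with $P(\alpha)=0$ whose leading coefficient is monic in $T$; $H(\alpha)$ and $\deg\alpha$ are its height and degree. For $\xi\in\mathbb{F}_q((T^{-1}))$ and $n,H\ge1$ let $w_n(\xi,H)=\min\{|P(\xi)|: P\in(\mathbb{F}_q[T])[X],H(P)\le H,\deg_XP\le n,P(\xi)\ne0\}$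 and $w_n^*(\xi,H)=\min\{|\xi-\alpha|:\alpha\in\overline{\mathbb{F}_q(T)},H(\alpha)\le H,\deg\alpha\le n,\alpha\ne\xi\}$; then $w_n(\xi)=\limsup_{H\to\infty}\frac{-\log w_n(\xi,H)}{\log H}$ and $w_n^*(\xi)=\limsup_{H\to\infty}\frac{-\log (H\,w_n^*(\xi,H))}{\log H}$. The notation $[a_0,a_1,a_2,\ldots]$ denotes the continued fraction $a_0+1/(a_1+1/(a_2+\cdots))$ with $a_i\in\mathbb{F}_q[T]$, $\deg a_i\ge1$ for $i\ge1$ (which converges in $\mathbb{F}_q((T^{-1}))$). *)

(* Defs.v *)
From HB Require Import structures.
From mathcomp Require Import all_boot all_order all_algebra all_field.
From mathcomp Require Import all_classical all_reals all_analysis.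
From mathcomp Require Import zify ring.

Set Implicit Arguments.
Unset Strict Implicit.
Unset Printing Implicit Defensive.

Import Order.TTheory GRing.Theory Num.Theory.
Local Open Scope classical_set_scope.
Local Open Scope ring_scope.

(* F((T^-1)): [x n] is the coefficient of T^(-n) in x. *)
Record laurent (F : fieldType) := Laurent {
  lcoef :> int -> F;
  lcoef_bounded : exists N : int, forall n, n < N -> lcoef n = 0 }.

HB.instance Definition _ (F : fieldType) := gen_eqMixin (laurent F).
HB.instance Definition _ (F : fieldType) := gen_choiceMixin (laurent F).

Section LaurentField.
Variable F : fieldType.
Implicit Types (x y z : laurent F) (a b c : nat -> F) (M N n : int).

Lemma laurentP x y : (forall n, x n = y n) -> x = y.
Proof.
case: x y => [f fP] [g gP] /= fg.
have fgE : f = g by apply/funext.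
by subst g; congr Laurent; exact: Prop_irrelevance.
Qed.

Lemma laurent0_subproof :
  exists N : int, forall n, n < N -> (fun=> 0 : F) n = 0.
Proof. by exists 0. Qed.
Definition laurent0 := Laurent laurent0_subproof.

Lemma laurent1_subproof :
  exists N : int, forall n, n < N -> ((n == 0)%:R : F) = 0.
Proof. by exists 0 => n n0; rewrite lt_eqF. Qed.
Definition laurent1 := Laurent laurent1_subproof.

Lemma laurent_opp_subproof x :
  exists N : int, forall n, n < N -> - x n = 0.
Proof. by have [N xN] := lcoef_bounded x; exists N => n /xN ->; rewrite oppr0. Qed.
Definition laurent_opp x := Laurent (laurent_opp_subproof x).

Lemma laurent_add_subproof x y :
  exists N : int, forall n, n < N -> x n + y n = 0.
Proof.
have [[M xM] [N yN]] := (lcoef_bounded x, lcoef_bounded y).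
by exists (Num.min M N) => n; rewrite lt_min => /andP[/xM -> /yN ->]; rewrite addr0.
Qed.
Definition laurent_add x y := Laurent (laurent_add_subproof x y).

Lemma laurent_mul_subproof x y :
  exists N : int, forall n, n < N ->
    \sum_(i \in [set: int]) x i * y (n - i) = 0.
Proof.
have [[M xM] [N yN]] := (lcoef_bounded x, lcoef_bounded y).
exists (M + N) => n nMN; apply: fsbig1 => i _.
have [/xM ->|Mi] := ltP i M; first by rewrite mul0r.
by rewrite yN ?mulr0//; lia.
Qed.
(* Only finitely many terms of the sum are nonzero. *)
Definition laurent_mul x y := Laurent (laurent_mul_subproof x y).

Lemma laurent_addA : associative laurent_add.
Proof. by move=> x y z; apply: laurentP => n /=; rewrite addrA. Qed.
Lemma laurent_addC : commutative laurent_add.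
Proof. by move=> x y; apply: laurentP => n /=; rewrite addrC. Qed.
Lemma laurent_add0 : left_id laurent0 laurent_add.
Proof. by move=> x; apply: laurentP => n /=; rewrite add0r. Qed.
Lemma laurent_addN : left_inverse laurent0 laurent_opp laurent_add.
Proof. by move=> x; apply: laurentP => n /=; rewrite addNr. Qed.

HB.instance Definition _ := GRing.isZmodule.Build (laurent F)
  laurent_addA laurent_addC laurent_add0 laurent_addN.

Let bnd x M := forall n, n < M -> x n = 0.
Let tail x M : nat -> F := fun i => x (M + i%:Z).
Let cauchy a b (k : nat) : F := \sum_(i < k.+1) a i * b (k - i)%N.

Let bnd_le x M N : M <= N -> bnd x N -> bnd x M.
Proof. by move=> MN xN n nM; apply: xN; apply: lt_le_trans MN. Qed.

Let eq_tail x y M : bnd x M -> bnd y M -> tail x M =1 tail y M -> x = y.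
Proof.
move=> xM yM xy; apply: laurentP => n.
have [nM|Mn] := ltP n M; first by rewrite xM ?yM.
have := xy `|n - M|%N; rewrite /tail.
by rewrite (_ : M + `|n - M|%N%:Z = n)//; lia.
Qed.

Let bnd_mul x y M N : bnd x M -> bnd y N -> bnd (laurent_mul x y) (M + N).
Proof.
move=> xM yN n nMN; apply: fsbig1 => i _.
have [/xM ->|Mi] := ltP i M; first by rewrite mul0r.
by rewrite yN ?mulr0//; lia.
Qed.

Let tail_mul x y M N : bnd x M -> bnd y N ->
  tail (laurent_mul x y) (M + N) =1 cauchy (tail x M) (tail y N).
Proof.
move=> xM yN k; rewrite /tail /cauchy /=.
have inj : injective (fun i : nat => M + i%:Z) by move=> i j /=; lia.
rewrite (fsbigE [seq M + i%:Z | i <- iota 0 k.+1]) ?map_inj_uniq ?iota_uniq//.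
- rewrite -[k.+1]subn0 big_map.
  rewrite -/(index_iota 0 (k.+1)) subn0 big_mkord.
  apply: eq_big => [i|i _]; first by rewrite in_setT.
  congr (_ * y _); have := ltn_ord i; lia.
- move=> i _ iN; have [/xM ->|Mi] := ltP i M; first by rewrite mul0r.
  rewrite yN ?mulr0//.
  suff : M + k%:Z < i by lia.
  rewrite ltNge; apply: contra iN => ik; apply/mapP; exists `|i - M|%N; last lia.
  by rewrite mem_iota; lia.
Qed.

Let trunc a (k : nat) : {poly F} := \poly_(i < k.+1) a i.

Let cauchyE a b (j k : nat) :
  (j <= k)%N -> cauchy a b j = (trunc a k * trunc b k)`_j.
Proof.
move=> jk; rewrite coefM; apply: eq_bigr => i _; rewrite !coef_poly.
by rewrite !ifT//; have := ltn_ord i; lia.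
Qed.

Let cauchyA a b c : cauchy a (cauchy b c) =1 cauchy (cauchy a b) c.
Proof.
move=> k.
transitivity (trunc a k * (trunc b k * trunc c k))`_k.
  rewrite coefM; apply: eq_bigr => i _; have := ltn_ord i => ik.
  by rewrite coef_poly ik (@cauchyE _ _ _ k)//; lia.
rewrite mulrA coefM; apply: eq_bigr => i _; have := ltn_ord i => ik.
by rewrite coef_poly ifT ?(@cauchyE _ _ i k)//; lia.
Qed.

Let cauchyC a b : cauchy a b =1 cauchy b a.
Proof. by move=> k; rewrite !(@cauchyE _ _ k k)// mulrC. Qed.

Let eq_cauchy a b a' b' : a =1 a' -> b =1 b' -> cauchy a b =1 cauchy a' b'.
Proof. by move=> aa bb k; apply: eq_bigr => i _; rewrite aa bb. Qed.

Let laurent_mulC : commutative laurent_mul.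
Proof.
move=> x y; have [[M xM] [N yN]] := (lcoef_bounded x, lcoef_bounded y).
apply: (eq_tail (M := M + N)); first exact: bnd_mul.
  by rewrite addrC; exact: bnd_mul.
move=> k; rewrite tail_mul// cauchyC -tail_mul//.
by rewrite addrC.
Qed.

Let laurent_mulA : associative laurent_mul.
Proof.
move=> x y z; have [[M xM] [N yN]] := (lcoef_bounded x, lcoef_bounded y).
have [K zK] := lcoef_bounded z.
apply: (eq_tail (M := M + (N + K))).
- by apply: bnd_mul => //; exact: bnd_mul.
- by rewrite addrA; apply: bnd_mul => //; exact: bnd_mul.
move=> k; rewrite tail_mul//; last exact: bnd_mul.
rewrite addrA tail_mul//; last exact: bnd_mul.
rewrite (eq_cauchy (fun=> erefl) (tail_mul yN zK)) cauchyA.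
by rewrite (eq_cauchy (tail_mul xM yN) (fun=> erefl)).
Qed.

Let bnd1 : bnd laurent1 0.
Proof. by move=> n n0 /=; rewrite lt_eqF. Qed.

Let tail1 (i : nat) : tail laurent1 0 i = (i == 0)%:R.
Proof. by rewrite /tail /= add0r. Qed.

Let laurent_mul1 : left_id laurent1 laurent_mul.
Proof.
move=> x; have [M xM] := lcoef_bounded x.
rewrite laurent_mulC; apply: (eq_tail (M := M)) => //.
  by rewrite -[M]addr0; exact: bnd_mul.
move=> k; rewrite -[in LHS](addr0 M) tail_mul// cauchyC.
rewrite /cauchy big_ord_recl tail1 mul1r subn0 big1 ?addr0// => i _.
by rewrite tail1 mul0r.
Qed.

Let laurent_mulD : left_distributive laurent_mul +%R.
Proof.
move=> x y z; have [[M' xM'] [N' yN']] := (lcoef_bounded x, lcoef_bounded y).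
pose M := Num.min M' N'.
have xM : bnd x M by apply: bnd_le xM'; rewrite ge_min lexx.
have yM : bnd y M by apply: bnd_le yN'; rewrite ge_min lexx orbT.
have xyM : bnd (x + y) M by move=> n nM /=; rewrite xM// yM// addr0.
have [K zK] := lcoef_bounded z.
apply: (eq_tail (M := M + K)); first exact: bnd_mul.
  move=> n nM /=.
  by rewrite -[X in X + _]/(laurent_mul x z n) -[X in _ + X]/(laurent_mul y z n)
             !(bnd_mul (M := M) (N := K)) ?addr0.
move=> k.
rewrite -[RHS]/(tail (laurent_mul x z) (M + K) k + tail (laurent_mul y z) (M + K) k).
rewrite !tail_mul// /cauchy -big_split /=.
by apply: eq_bigr => i _; rewrite -mulrDl.
Qed.

Let laurent1_neq0 : laurent1 != 0.
Proof.
apply/eqP => /(congr1 (fun x : laurent F => x 0)) /= /eqP.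
by rewrite (negbTE (oner_neq0 F)).
Qed.

HB.instance Definition _ := GRing.Zmodule_isComNzRing.Build (laurent F)
  laurent_mulA laurent_mulC laurent_mul1 laurent_mulD laurent1_neq0.

Lemma laurent_order_ex x : x != 0 ->
  exists N : int, x N != 0 /\ forall n, n < N -> x n = 0.
Proof.
move=> x0; have [M xM] := lcoef_bounded x.
have ex : exists i : nat, tail x M i != 0.
  apply: contrapT => /forallNP nex; move/eqP: x0; apply.
  apply: (eq_tail (M := M)) => // i.
  by have /negP := nex i; rewrite negbK => /eqP.
exists (M + (ex_minn ex)%:Z); case: ex_minnP => k xk kmin; split => // n nk.
have [/xM//|Mn] := ltP n M; apply/eqP; apply: contraT => xn.
have := kmin `|n - M|%N; rewrite /tail (_ : M + `|n - M|%N%:Z = n); last lia.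
by move=> /(_ xn); lia.
Qed.

Let cauchy_inv a : a 0%N != 0 ->
  exists b, cauchy a b =1 fun k => (k == 0)%:R.
Proof.
move=> a0.
pose step (s : seq F) := rcons s (((size s == 0)%N%:R -
  \sum_(i < size s) a i.+1 * s`_(size s - i.+1)%N) / a 0%N).
pose s k := iter k step [::].
have sz k : size (s k) = k by elim: k => //= k IH; rewrite size_rcons IH.
have sE k l : (k < l)%N -> (s l)`_k = (s k.+1)`_k.
  elim: l => // l IH; rewrite ltnS leq_eqVlt => /predU1P[->//|kl].
  by rewrite /= nth_rcons sz kl IH.
exists (fun k => (s k.+1)`_k) => k.
rewrite /cauchy big_ord_recl subn0.
have -> : (s k.+1)`_k =
    ((k == 0)%:R - \sum_(i < k) a i.+1 * (s k)`_(k - i.+1)) / a 0%N.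
  by rewrite /= nth_rcons sz ltnn eqxx.
rewrite mulrC divfK//.
rewrite [X in _ + X](eq_bigr (fun i : 'I_k => a i.+1 * (s k)`_(k - i.+1))) ?subrK// => i _.
have := ltn_ord i => ik; rewrite lift0; congr (_ * _).
by rewrite -(@sE (k - i.+1)%N k)//; lia.
Qed.

Let laurent_inv_ex x : x != 0 -> exists y, x * y = 1.
Proof.
move=> /laurent_order_ex[N [xN0 xN]].
have [b ab] : exists b, cauchy (tail x N) b =1 fun k => (k == 0)%:R.
  by apply: cauchy_inv; rewrite /tail addr0.
have yP : exists K : int, forall n, n < K ->
    (if n < - N then 0 else b `|(n + N)%R|%N) = 0.
  by exists (- N) => n ->.
pose y := Laurent yP.
have yN : bnd y (- N) by move=> n /= ->.
exists y; apply: (eq_tail (M := N + - N)).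
- exact: bnd_mul.
- by rewrite subrr.
move=> k; rewrite tail_mul// subrr tail1 -ab; apply: eq_cauchy => // i.
by rewrite /tail /= ifF; [congr b|]; lia.
Qed.

Definition laurent_inv x : laurent F := xget 0 [set y | x * y = 1].

Let laurent_mulV x : x != 0 -> laurent_inv x * x = 1.
Proof.
move=> /laurent_inv_ex[y xy]; rewrite mulrC /laurent_inv.
by case: xgetP => [z _ //|/(_ y)].
Qed.

Let laurent_inv0 : laurent_inv 0 = 0.
Proof.
rewrite /laurent_inv; case: xgetP => // y _ /= /eqP.
by rewrite mul0r eq_sym oner_eq0.
Qed.

HB.instance Definition _ :=
  GRing.ComNzRing_isField.Build (laurent F) laurent_mulV laurent_inv0.

Lemma laurent_of_poly_subproof (f : {poly F}) :
  exists N : int, forall n, n < N -> (if n <= 0 then f`_`|n|%N else 0) = 0.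
Proof.
exists (- (size f)%:Z) => n nf; rewrite ifT; last by lia.
have fn : (size f <= `|n|)%N by lia.
by rewrite nth_default.
Qed.
(* The inclusion of F[T]: T is the series whose only nonzero coefficient has
   index -1. *)
Definition laurent_of_poly (f : {poly F}) := Laurent (laurent_of_poly_subproof f).

Let laurent_of_poly_additive : zmod_morphism laurent_of_poly.
Proof.
move=> f g; apply: laurentP => n /=; case: ifP; last by rewrite subr0.
by rewrite coefB.
Qed.

HB.instance Definition _ := GRing.isZmodMorphism.Build {poly F} (laurent F)
  laurent_of_poly laurent_of_poly_additive.

Let laurent_of_poly_multiplicative : monoid_morphism laurent_of_poly.
Proof.
split=> [|f g]; first apply: laurentP => n /=.
  rewrite coef1; case: ifP => n0; first by rewrite absz_eq0.
  by rewrite (_ : (n == 0) = false)//; lia.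
apply: laurentP => n.
rewrite [LHS]/= -[RHS]/(\sum_(i \in [set: int])
  laurent_of_poly f i * laurent_of_poly g (n - i)).
rewrite (fsbigE [seq - i%:Z | i <- iota 0 (size f)]).
- rewrite big_map [RHS](eq_bigl xpredT); last by move=> i; rewrite in_setT.
  rewrite -[size f]subn0 -/(index_iota 0 (size f)) big_mkord.
  have [n0|n0] := leP n 0; last first.
    apply/esym/big1 => i _ /=; rewrite [X in _ * X]ifF ?mulr0//; lia.
  transitivity (\sum_(i < size f) if (i <= `|n|)%N then f`_i * g`_(`|n| - i) else 0).
    rewrite coefM -!(big_mkord xpredT (fun i => f`_i * g`_(`|n| - i))).
    rewrite -(big_mkord xpredT
      (fun i => if (i <= `|n|)%N then f`_i * g`_(`|n| - i) else 0)).
    rewrite -big_mkcond /=.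
    rewrite (big_nat_widen _ _ (`|n|.+1 + size f))%N ?leq_addr//.
    rewrite [RHS](big_nat_widen _ _ (`|n|.+1 + size f))%N ?leq_addl//.
    rewrite [LHS]big_mkcond [RHS]big_mkcond; apply: eq_bigr => i _ /=.
    rewrite ltnS; have [il|il] := leqP i `|n| => /=; last by [].
    by have [//|sf] := ltnP i (size f); rewrite nth_default// mul0r.
  apply: eq_bigr => i _ /=.
  move: (nat_of_ord i) => {}i; rewrite oppr_le0 abszN opprK /=.
  have [il|il] := leqP i `|n|; last by rewrite ifF ?mulr0//; lia.
  by rewrite ifT; [congr (f`_ _ * g`_ _)|]; lia.
- by rewrite map_inj_uniq ?iota_uniq// => i j; lia.
- by [].
- move=> i _ iN /=; have [i0|//] := leP i 0; last by rewrite mul0r.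
  rewrite nth_default ?mul0r// leqNgt; apply: contra iN => ilt.
  by apply/mapP; exists `|i|%N; [rewrite mem_iota add0n|lia].
Qed.

HB.instance Definition _ := GRing.isMonoidMorphism.Build {poly F} (laurent F)
  laurent_of_poly laurent_of_poly_multiplicative.

End LaurentField.

Section AbsoluteValue.
Variables (R : realType) (F : finFieldType).
Implicit Types (x : laurent F) (P : {poly {poly F}}).

Definition laurent_order x : int :=
  xget 0 [set N : int | x N != 0 /\ forall n, n < N -> x n = 0].

Definition laurent_abs x : R :=
  if x == 0 then 0 else #|F|%:R ^ (- laurent_order x).

(* P is a polynomial in X whose coefficients are polynomials in T. *)
Definition height P : R :=
  \big[Num.max/0]_(i < size P) laurent_abs (laurent_of_poly P`_i).

Definition absolute_value (K : fieldType) (v : K -> R) : Prop :=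
  [/\ forall z, 0 <= v z,
      forall z, v z = 0 <-> z = 0,
      forall y z, v (y * z) = v y * v z &
      forall y z, v (y + z) <= v y + v z].

(* The value 0 is junk, for sets of reals without a least element. *)
Definition minimum (A : set R) : R := xget 0 (A `&` lbound A).

End AbsoluteValue.
Arguments laurent_abs R {F} x.
Arguments height R {F} P.

Section ContinuedFraction.
Variables (R : realType) (F : finFieldType).

Fixpoint convergent (a : nat -> laurent F) (n : nat) : laurent F :=
  if n is m.+1 then a 0%N + (convergent (fun i => a i.+1) m)^-1 else a 0%N.

(* The value of [a 0, a 1, a 2, ...]: the limit of the convergents, which is
   unique when it exists. *)
Definition cfrac (a : nat -> {poly F}) : laurent F :=
  xget 0 [set x | forall e : R, 0 < e -> exists N : nat, forall n : nat,
    (N <= n)%N ->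
    laurent_abs R (x - convergent (fun i => laurent_of_poly (a i)) n) < e].

Definition partial_quotient (w : R) (b c : {poly F}) (n : nat) : {poly F} :=
  if n == 0%N then 0
  else if `[< exists i : nat, n%:Z = Num.floor (w ^+ i) >] then c else b.

Definition xi_ (w : R) (b c : {poly F}) : laurent F :=
  cfrac (partial_quotient w b c).

End ContinuedFraction.

Section PolynomialExponent.
Variables (R : realType) (F : finFieldType) (n : nat) (xi : laurent F).

Definition best_poly (H : nat) : R :=
  minimum [set laurent_abs R (map_poly (@laurent_of_poly F) P).[xi] |
    P in [set P : {poly {poly F}} |
      [/\ height R P <= H%:R, (size P <= n.+1)%N &
          (map_poly (@laurent_of_poly F) P).[xi] != 0]]].

Definition poly_exponent : \bar R :=
  limn_esup (fun H : nat => (- ln (best_poly H) / ln H%:R)%:E).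

End PolynomialExponent.

(* phi : F((T^-1)) -> L is an algebraic closure, and absL the extension to L
   of the absolute value. *)
Section AlgebraicExponent.
Variables (R : realType) (F : finFieldType) (L : closedFieldType).
Variables (phi : {rmorphism laurent F -> L}) (absL : L -> R).
Implicit Types (alpha : L) (P : {poly {poly F}}).

Definition closure_of_poly (f : {poly F}) : L := phi (laurent_of_poly f).

Definition closure_of_ratfun (r : {fraction {poly F}}) : L :=
  closure_of_poly (frac (repr r)).1 / closure_of_poly (frac (repr r)).2.

Definition irreducible_elt (A : unitRingType) (x : A) : Prop :=
  [/\ x != 0, x \isn't a GRing.unit &
      forall y z, x = y * z -> y \is a GRing.unit \/ z \is a GRing.unit].

Definition primitive P : Prop :=
  forall d : {poly F}, (forall i : nat, d %| P`_i) -> d \is a GRing.unit.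

Definition is_minimal_poly alpha P : Prop :=
  [/\ (1 < size P)%N, irreducible_elt P, primitive P,
      root (map_poly closure_of_poly P) alpha & lead_coef P \is monic].

Definition minimal_poly alpha : {poly {poly F}} :=
  xget 0 [set P | is_minimal_poly alpha P].

Definition alg_height alpha : R := height R (minimal_poly alpha).
Definition alg_degree alpha : nat := (size (minimal_poly alpha)).-1.

Variables (n : nat) (xi : laurent F).

Definition best_alg (H : nat) : R :=
  minimum [set absL (phi xi - alpha) |
    alpha in [set alpha : L |
      [/\ algebraicOver closure_of_ratfun alpha, alg_height alpha <= H%:R,
          (alg_degree alpha <= n)%N & alpha != phi xi]]].

Definition alg_exponent : \bar R :=
  limn_esup (fun H : nat => (- ln (H%:R * best_alg H) / ln H%:R)%:E).

End AlgebraicExponent.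

(* Main.v *)
Require Import Defs.
From HB Require Import structures.
From mathcomp Require Import all_boot all_order all_algebra all_field.
From mathcomp Require Import all_classical all_reals all_analysis.
From mathcomp Require Import zify ring lra.

Set Implicit Arguments.
Unset Strict Implicit.
Unset Printing Implicit Defensive.

Import Order.TTheory GRing.Theory Num.Theory.
Local Open Scope classical_set_scope.
Local Open Scope ring_scope.

(* Let n_j = floor(w^j), let X_j be the absolute value of the denominator q_(n_j)
   of xi = xi_w, and let alpha_j = [0, a_1, ..., a_(n_j), b, b, ...], a quadratic
   number of height at most C X_j^2.  The expansions of xi and alpha_j first
   differ at index n_(j+1), so |xi - alpha_j| is of order X_(j+1)^-2, while the
   conjugate alpha_j' satisfies |xi - alpha_j'| ~ X_j^-2.  As
   log X_(j+1) / log X_j tends to w, this gives the lower bounds.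

   For the upper bounds let P = u X^2 + v X + t have height at most H.  With
   beta = [b, b, ...] and q the denominator of alpha_j as a Moebius image of beta,
   q^2 P(alpha_j) lies in F[T][beta] and its norm lies in F[T].  If the norm is 0,
   then P is a multiple of the polynomial of alpha_j, and the discriminant of P
   bounds |u| below by X_j^2 / C.  Otherwise the norm has absolute value at least
   1, and for H X_j << X_(j+1) this forces |P(xi)| >> H^-1 X_j^-2.  Choosing the
   least such j gives the exponent 1 + 2w/(w-1), which is at most w - 1 exactly
   when w^2 - 5w + 2 >= 0, i.e. when w >= (5 + sqrt 17)/2; separability plays no
   role, so that this also covers characteristic 2. *)

(** * The absolute value of Laurent series *)

(** The bound w - 1 that non-multiples must meet is dictated by w_2^*. For a root alpha of P near xi
    one has |P(xi)| <= 2 H |xi - alpha|, so a factor H is lost when a bound on |P(xi)| becomes one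
    on |xi - alpha|. Polynomials with nonzero norm must therefore satisfy the exponent w - 1,
    although w_2 = w. The multiples of the polynomial of alpha_j could not satisfy it; they are
    treated through their roots, which are alpha_j and alpha_j' themselves. Height at most H forces
    X_j^2 << H there, hence |xi - alpha_j| >> X_(j+1)^-2 >> H^-(w + epsilon).

    A norm of absolute value at least 1 is useful because alpha_j and alpha_j' both lie near xi. If
    |P(xi)| were smaller than both errors |P(alpha_j) - P(xi)| and |P(alpha_j') - P(xi)|, the norm
    would be of order at most (H X_j / X_(j+1))^2, which the choice of the level keeps below 1.

    That a norm vanishes only with its argument means that beta is irrational. This is proved by a
    descent on degrees in F[T], so no square root of a discriminant is ever taken. *)

Section LaurentAbs.
Variables (R : realType) (F : finFieldType).
Implicit Types (x y : laurent F) (f : {poly F}) (N n : int).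

Local Notation q := (#|F|%:R : R).
Local Notation abs := (laurent_abs R).

Lemma card_gt1 : 1 < q.
Proof. by rewrite ltr1n finNzRing_gt1. Qed.

Lemma laurent_orderP x : x != 0 ->
  x (laurent_order x) != 0 /\ forall n, n < laurent_order x -> x n = 0.
Proof. by move=> /laurent_order_ex; rewrite /laurent_order => /(xgetPex 0). Qed.

Lemma laurent_order_uniq x N :
  x N != 0 -> (forall n, n < N -> x n = 0) -> laurent_order x = N.
Proof.
move=> xN ltN; have x0 : x != 0 by apply: contraNneq xN => ->.
have [xo lto] := laurent_orderP x0.
case: (ltgtP (laurent_order x) N) => // h; first by rewrite ltN ?eqxx in xo.
by rewrite lto ?eqxx in xN.
Qed.

Lemma abs0 : abs (0 : laurent F) = 0.
Proof. by rewrite /laurent_abs eqxx. Qed.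

Lemma abs_gt0 x : (0 < abs x) = (x != 0).
Proof.
rewrite /laurent_abs; case: eqP => _; first by rewrite ltxx.
by rewrite exprz_gt0// (lt_trans _ card_gt1).
Qed.

Lemma abs_ge0 x : 0 <= abs x.
Proof.
by have [->|x0] := eqVneq x 0; [rewrite abs0|rewrite ltW// abs_gt0].
Qed.

Lemma abs_eq0 x : (abs x == 0) = (x == 0).
Proof. by have := abs_gt0 x; rewrite lt_def abs_ge0 andbT => /negb_inj. Qed.

(** Turns a bound on the absolute value into the vanishing of coefficients; the ultrametric
    inequality and completeness both reduce to it. *)
Lemma abs_leP x N :
  reflect (forall n, n < N -> x n = 0) (abs x <= q ^ (- N)).
Proof.
have [->|x0] := eqVneq x 0.
  by rewrite abs0 exprz_ge0 ?ler0n//; constructor.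
have [xo lto] := laurent_orderP x0.
rewrite /laurent_abs (negbTE x0) ler_eXz2l ?card_gt1// lerN2.
apply: (iffP idP) => [No n nN|ltN]; first by apply: lto; apply: lt_le_trans No.
by rewrite leNgt; apply: contra xo => /ltN ->.
Qed.

Lemma absD x y : abs (x + y) <= Num.max (abs x) (abs y).
Proof.
wlog xy : x y / abs x <= abs y.
  by move=> h; case/orP: (le_total (abs x) (abs y)) => /h//; rewrite addrC maxC.
rewrite (max_idPr xy).
have [y0|y0] := eqVneq y 0.
  by move: xy; rewrite y0 abs0 addr0.
have yE : abs y = q ^ (- laurent_order y) by rewrite /laurent_abs (negbTE y0).
move: xy; rewrite yE => /abs_leP xN.
have [_ yN] := laurent_orderP y0.
by apply/abs_leP => n nN /=; rewrite -[LHS]/(x n + y n) xN// yN// addr0.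
Qed.

Lemma absM x y : abs (x * y) = abs x * abs y.
Proof.
have [->|x0] := eqVneq x 0; first by rewrite mul0r abs0 mul0r.
have [->|y0] := eqVneq y 0; first by rewrite mulr0 abs0 mulr0.
have [[xo xlt] [yo ylt]] := (laurent_orderP x0, laurent_orderP y0).
rewrite /laurent_abs mulf_eq0 (negbTE x0) (negbTE y0) /=.
rewrite -expfzDr ?gt_eqF ?(lt_trans _ card_gt1)// -opprD; congr (_ ^ (- _)).
have mulE n : (x * y) n = \sum_(i \in [set: int]) x i * y (n - i) by [].
apply: laurent_order_uniq => [|n nlt]; rewrite mulE.
  rewrite (fsbigE [:: laurent_order x])//.
    by rewrite big_mkcond big_seq1 in_setT addrC addKr mulf_neq0.
  move=> i _; rewrite inE => io.
  have [/xlt ->|oi] := ltP i (laurent_order x); first by rewrite mul0r.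
  by rewrite ylt ?mulr0//; lia.
apply: fsbig1 => i _.
have [/xlt ->|oi] := ltP i (laurent_order x); first by rewrite mul0r.
by rewrite ylt ?mulr0//; lia.
Qed.

Lemma abs1 : abs (1 : laurent F) = 1.
Proof.
have a1 : abs (1 : laurent F) != 0 by rewrite abs_eq0 oner_eq0.
by apply: (mulfI a1); rewrite -absM !mulr1.
Qed.

Lemma absN x : abs (- x) = abs x.
Proof.
suff aN1 : abs (-1 : laurent F) = 1 by rewrite -mulN1r absM aN1 mul1r.
apply/eqP; rewrite -(@pexpr_eq1 _ _ 2) ?abs_ge0//.
by rewrite expr2 -absM mulrNN mulr1 abs1.
Qed.

Lemma absB x y : abs (x - y) <= Num.max (abs x) (abs y).
Proof. by rewrite -(absN y) absD. Qed.

Lemma absBC x y : abs (x - y) = abs (y - x).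
Proof. by rewrite -absN opprB. Qed.

Lemma absD_lt x y : abs x < abs y -> abs (x + y) = abs y.
Proof.
move=> xy; apply/le_anti; rewrite -{1}(max_idPr (ltW xy)) absD /=.
have := absB (x + y) x; rewrite [x + y]addrC addrK le_max => /orP[//|].
by rewrite leNgt xy.
Qed.

Lemma absV x : abs x^-1 = (abs x)^-1.
Proof.
have [->|x0] := eqVneq x 0; first by rewrite invr0 abs0 invr0.
have ax : abs x != 0 by rewrite abs_eq0.
by apply: (mulfI ax); rewrite -absM !divff// abs1.
Qed.

Lemma absX x k : abs (x ^+ k) = abs x ^+ k.
Proof. by elim: k => [|k IH]; rewrite ?abs1// !exprS absM IH. Qed.

Lemma absD_le x y (r : R) : abs x <= r -> abs y <= r -> abs (x + y) <= r.
Proof. by move=> xr yr; rewrite (le_trans (absD _ _))// ge_max xr. Qed.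

Lemma absB_le x y (r : R) : abs x <= r -> abs y <= r -> abs (x - y) <= r.
Proof. by move=> xr yr; rewrite absD_le// absN. Qed.

Lemma absD_ltr x y (r : R) : abs x < r -> abs y < r -> abs (x + y) < r.
Proof. by move=> xr yr; rewrite (le_lt_trans (absD _ _))// gt_max xr. Qed.

Local Notation inj := (@laurent_of_poly F).

Lemma abs_poly f : f != 0 -> abs (inj f) = q ^+ (size f).-1.
Proof.
move=> f0; have sf : (0 < size f)%N by rewrite size_poly_gt0.
have lf : laurent_of_poly f (- (size f).-1%:Z) != 0.
  by rewrite /= ifT ?abszN /= -?lead_coefE ?lead_coef_eq0//; lia.
have fx0 : inj f != 0 by apply: contraNneq lf => ->.
rewrite /laurent_abs (negbTE fx0) (@laurent_order_uniq _ (- (size f).-1%:Z))//.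
  by rewrite opprK.
move=> n nf /=; have fn : (size f <= `|n|)%N by lia.
by rewrite ifT ?nth_default//; lia.
Qed.

Lemma laurent_of_poly_inj : injective inj.
Proof.
move=> f g fg; apply/polyP => i.
have := congr1 (fun x : laurent F => x (- i%:Z)) fg.
by rewrite /= oppr_le0 abszN.
Qed.

Lemma laurent_of_poly_eq0 f : (inj f == 0) = (f == 0).
Proof. by rewrite -(rmorph0 inj) (inj_eq laurent_of_poly_inj). Qed.

Lemma abs_poly_ge1 f : f != 0 -> 1 <= abs (inj f).
Proof. by move=> f0; rewrite abs_poly// exprn_ege1// ltW ?card_gt1. Qed.

Lemma abs_poly_gt1 f : (1 < size f)%N -> 1 < abs (inj f).
Proof.
move=> f1; have f0 : f != 0 by rewrite -size_poly_gt0 ltnW.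
by rewrite abs_poly// exprn_egt1 ?card_gt1//; lia.
Qed.

End LaurentAbs.

(** * Continued fractions *)

Section Completeness.
Variables (R : realType) (F : finFieldType).
Local Notation q := (#|F|%:R : R).
Local Notation abs := (laurent_abs R).

(** The hypothesis freezes the coefficient of index n from step max(n, 0) on, so the limit is read
    off diagonally, coefficient n being taken from [x (idx n)]. *)
Lemma laurent_complete (x : nat -> laurent F) :
  (forall k, abs (x k.+1 - x k) <= q ^- k.+1) ->
  exists y, forall k, abs (y - x k) <= q ^- k.+1.
Proof.
move=> xc.
have eqx (k l : nat) (n : int) : n <= k%:Z -> x (k + l)%N n = x k n.
  move=> nk; elim: l => [|l <-]; first by rewrite addn0.
  have := xc (k + l)%N; rewrite exprnN => /abs_leP/(_ n) h.
  by apply/eqP; rewrite addnS -subr_eq0; apply/eqP/h; lia.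
pose idx (n : int) : nat := if n <= 0 then 0%N else `|n|%N.
have yP : exists N : int, forall n, n < N -> x (idx n) n = 0.
  have [N xN] := lcoef_bounded (x 0%N).
  exists (Num.min N 0) => n; rewrite lt_min => /andP[nN n0].
  by rewrite /idx (ltW n0) xN.
exists (Laurent yP) => k; rewrite exprnN; apply/abs_leP => n nk.
rewrite -[LHS]/(x (idx n) n - x k n); apply/eqP; rewrite subr_eq0; apply/eqP.
have ik : (idx n <= k)%N by rewrite /idx; case: (leP n 0) => n0; lia.
have ni : n <= (idx n)%:Z by rewrite /idx; case: (leP n 0) => n0; lia.
by rewrite -(subnKC ik) eqx.
Qed.

End Completeness.

(* Indices are shifted by one: cf_num a n.+1 and cf_den a n.+1 are p_n and q_n,
   while cf_num a 0 = p_(-1) = 1 and cf_den a 0 = q_(-1) = 0. *)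
Fixpoint cf_num (F : fieldType) (a : nat -> {poly F}) (n : nat) : {poly F} :=
  if n is n1.+1 then
    if n1 is n2.+1 then a n1 * cf_num a n1 + cf_num a n2 else a 0%N
  else 1.

Fixpoint cf_den (F : fieldType) (a : nat -> {poly F}) (n : nat) : {poly F} :=
  if n is n1.+1 then
    if n1 is n2.+1 then a n1 * cf_den a n1 + cf_den a n2 else 1
  else 0.

Section ContinuedFractions.
Variables (R : realType) (F : finFieldType).
Implicit Types (a : nat -> {poly F}) (y : laurent F).
Local Notation q := (#|F|%:R : R).
Local Notation abs := (laurent_abs R).
Local Notation inj := (@laurent_of_poly F).

Lemma cf_numS a n : cf_num a n.+2 = a n.+1 * cf_num a n.+1 + cf_num a n.
Proof. by []. Qed.

Lemma cf_denS a n : cf_den a n.+2 = a n.+1 * cf_den a n.+1 + cf_den a n.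
Proof. by []. Qed.

(** Bridges two recursions: [convergent] unfolds from the first partial quotient, [cf_num] and
    [cf_den] from the last one. *)
Lemma cf_shift a n : let a' i := a i.+1 in
  cf_num a n.+1 = a 0%N * cf_num a' n + cf_den a' n /\
  cf_den a n.+1 = cf_num a' n.
Proof.
move=> a'; elim/ltn_ind: n => -[|[|n]] IH.
- by rewrite /= mulr1 addr0.
- by rewrite /= mulr1 addr0 mulrC.
have [n1 d1] := IH n.+1 (ltnSn _); have [n0 d0] := IH n (ltnW (ltnSn _)).
rewrite [cf_num a n.+3]cf_numS n1 n0 [cf_den a n.+3]cf_denS d1 d0.
rewrite [cf_num a' n.+2]cf_numS [cf_den a' n.+2]cf_denS.
by split => //; rewrite /a'; ring.
Qed.

Lemma cf_det a n :
  cf_num a n.+1 * cf_den a n - cf_num a n * cf_den a n.+1 = (-1) ^+ n.+1.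
Proof.
elim: n => [|n IH]; first by rewrite /= mulr0 mulr1 sub0r expr1.
by rewrite cf_numS cf_denS exprS -IH; ring.
Qed.

Lemma cf_detE a n : inj (cf_num a n.+1) * inj (cf_den a n) -
  inj (cf_num a n) * inj (cf_den a n.+1) = (-1) ^+ n.+1.
Proof. by rewrite -!rmorphM -rmorphB cf_det rmorphXn rmorphN rmorph1. Qed.

Definition cf_coef a := forall i, (1 < size (a i.+1))%N.

Lemma cf_den_lt a n : cf_coef a ->
  abs (inj (cf_den a n)) < abs (inj (cf_den a n.+1)).
Proof.
move=> ha; elim: n => [|n IH]; first by rewrite rmorph0 rmorph1 abs0 abs1.
rewrite cf_denS rmorphD addrC absD_lt rmorphM absM.
  by rewrite ltr_pMl ?abs_poly_gt1// (le_lt_trans _ IH)// abs_ge0.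
by rewrite (lt_trans IH)// ltr_pMl ?abs_poly_gt1// (le_lt_trans _ IH)// abs_ge0.
Qed.

Lemma cf_den_neq0 a n : cf_coef a -> inj (cf_den a n.+1) != 0.
Proof.
by move=> ha; rewrite -(abs_gt0 R) (le_lt_trans _ (cf_den_lt n ha))// abs_ge0.
Qed.

Lemma abs_cf_denS a n : cf_coef a -> abs (inj (cf_den a n.+2)) =
  abs (inj (a n.+1)) * abs (inj (cf_den a n.+1)).
Proof.
move=> ha; rewrite cf_denS rmorphD addrC absD_lt rmorphM absM//.
rewrite (lt_trans (cf_den_lt n ha))// ltr_pMl ?abs_poly_gt1//.
by rewrite abs_gt0 cf_den_neq0.
Qed.

Lemma cf_den_ge a n : cf_coef a -> q ^+ n <= abs (inj (cf_den a n.+1)).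
Proof.
move=> ha; elim: n => [|n IH]; first by rewrite expr0 rmorph1 abs1.
rewrite abs_cf_denS// exprS ler_pM ?exprn_ge0//.
rewrite abs_poly -?size_poly_gt0; last exact: ltnW (ha n).
by rewrite -[leLHS]expr1 ler_eXn2l ?card_gt1//; have := ha n; case: (size _) => [|[]].
Qed.

Lemma cf_den_le a m n : cf_coef a -> (m <= n)%N ->
  abs (inj (cf_den a m)) <= abs (inj (cf_den a n)).
Proof.
move=> ha; elim: n => [|n IH]; first by rewrite leqn0 => /eqP ->.
rewrite leq_eqVlt => /predU1P[->//|]; rewrite ltnS => /IH /le_trans; apply.
exact/ltW/cf_den_lt.
Qed.

Lemma convergentE a n : cf_coef a ->
  convergent (inj \o a) n = inj (cf_num a n.+1) / inj (cf_den a n.+1).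
Proof.
elim: n a => [|n IH] a ha; first by rewrite /= rmorph1 divr1.
have ha' : cf_coef (fun i => a i.+1) by move=> i; apply: ha.
rewrite [LHS]/(inj (a 0%N) + (convergent (inj \o fun i => a i.+1) n)^-1).
have [-> dE] := cf_shift a n.+1; rewrite IH// dE.
have num0 : inj (cf_num (fun i => a i.+1) n.+1) != 0.
  by rewrite -dE cf_den_neq0.
by rewrite invf_div rmorphD rmorphM mulrDl mulfK.
Qed.

Lemma convergent_step a n : cf_coef a ->
  abs (convergent (inj \o a) n.+1 - convergent (inj \o a) n) =
  (abs (inj (cf_den a n.+1)) * abs (inj (cf_den a n.+2)))^-1.
Proof.
move=> ha; rewrite !convergentE// -absM -absV.
have [d1 d2] := (cf_den_neq0 n ha, cf_den_neq0 n.+1 ha).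
have det := cf_detE a n.+1.
suff -> : inj (cf_num a n.+2) / inj (cf_den a n.+2) -
    inj (cf_num a n.+1) / inj (cf_den a n.+1) =
    (-1) ^+ n.+2 * (inj (cf_den a n.+1) * inj (cf_den a n.+2))^-1.
  by rewrite absM absX absN abs1 expr1n mul1r.
by rewrite -det; field; rewrite d1 d2.
Qed.

Definition cf_limit a y := forall e : R, 0 < e -> exists N : nat,
  forall n : nat, (N <= n)%N -> abs (y - convergent (inj \o a) n) < e.

Lemma cf_limit_ex a : cf_coef a -> exists y, cf_limit a y.
Proof.
move=> ha; have [|y yx] := @laurent_complete R F (convergent (inj \o a)).
  move=> k; rewrite convergent_step// lef_pV2 ?posrE.
  - rewrite -[leLHS]mul1r ler_pM// ?exprn_ge0//; last exact: cf_den_ge.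
    by rewrite (le_trans _ (cf_den_ge k ha))// exprn_ege1// ltW// card_gt1.
  - by rewrite mulr_gt0// abs_gt0 cf_den_neq0.
  - by rewrite exprn_gt0// (lt_trans _ (card_gt1 _ _)).
exists y => e e0; exists (Num.truncn e^-1).+1 => n en.
apply: le_lt_trans (yx n) _; rewrite -[ltRHS]invrK ltf_pV2 ?posrE ?invr_gt0//;
  last by rewrite exprn_gt0// (lt_trans _ (card_gt1 _ _)).
have e1 : e^-1 <= n%:R by rewrite (le_trans (ltW (truncnS_gt _)))// ler_nat.
apply: le_lt_trans e1 _; rewrite -natrX ltr_nat.
by rewrite (leq_ltn_trans (leqnSn n))// ltn_expl// finNzRing_gt1.
Qed.

(** Telescoping the steps |q_k q_(k+1)|^-1 ultrametrically keeps all later convergents, hence the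
    limit, at distance less than |q_n|^-2 from p_n/q_n. The product form also covers index 0, where
    [cf_den] is 0. *)
Lemma cf_approx a y n : cf_coef a -> cf_limit a y ->
  abs (inj (cf_den a n) * y - inj (cf_num a n)) * abs (inj (cf_den a n)) < 1.
Proof.
move=> ha yl; case: n => [|n]; first by rewrite /= rmorph0 abs0 mulr0.
have d0 : inj (cf_den a n.+1) != 0 by exact: cf_den_neq0.
pose r : R := (abs (inj (cf_den a n.+1)) ^+ 2)^-1.
have r0 : 0 < r by rewrite invr_gt0 exprn_gt0// abs_gt0.
have step k : (n <= k)%N ->
    abs (convergent (inj \o a) k - convergent (inj \o a) n) < r.
  elim: k => [|k IH]; first by rewrite leqn0 => /eqP ->; rewrite subrr abs0.
  rewrite leq_eqVlt => /predU1P[->|]; first by rewrite subrr abs0.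
  rewrite ltnS => nk; set c := convergent _.
  have -> : c k.+1 - c n = (c k.+1 - c k) + (c k - c n) by rewrite addrA subrK.
  apply: absD_ltr; last exact: IH.
  rewrite convergent_step// ltf_pV2 ?posrE ?exprn_gt0 ?mulr_gt0 ?abs_gt0 ?cf_den_neq0//.
  rewrite expr2; apply: (@le_lt_trans _ _ (abs (inj (cf_den a k.+1)) ^+ 2)).
    by rewrite expr2 ler_pM ?abs_ge0// cf_den_le.
  by rewrite expr2 ltr_pM2l ?cf_den_lt// abs_gt0 cf_den_neq0.
have [N yN] := yl r r0.
have /(@absD_ltr R F _ _ r) := yN (maxn N n) (leq_maxl _ _).
move=> /(_ _ (step (maxn N n) (leq_maxr _ _))).
rewrite addrA subrK convergentE// => lt_r.
suff -> : inj (cf_den a n.+1) * y - inj (cf_num a n.+1) = inj (cf_den a n.+1) *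
    (y - inj (cf_num a n.+1) / inj (cf_den a n.+1)).
  rewrite absM mulrAC -expr2.
  by rewrite -(mulfV (lt0r_neq0 r0)) invrK mulrC ltr_pM2r ?exprn_gt0 ?abs_gt0.
by field.
Qed.

(** Here z is the complete quotient [a_(m+1), a_(m+2), ...], obtained without a further limit as
    minus the ratio of two consecutive remainders [d n]. The remainders satisfy the recurrence of
    the denominators, and the determinant identity gives their exact size, since one of its two
    terms is less than 1. *)
Lemma complete_quotient a y m : cf_coef a -> cf_limit a y ->
  exists2 z, abs (z - inj (a m.+1)) < 1 &
    y * (inj (cf_den a m.+1) * z + inj (cf_den a m)) =
    inj (cf_num a m.+1) * z + inj (cf_num a m).
Proof.
move=> ha yl; pose d n := inj (cf_den a n) * y - inj (cf_num a n).
have dS n : d n.+2 = inj (a n.+1) * d n.+1 + d n.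
  by rewrite /d cf_denS cf_numS !rmorphD !rmorphM; ring.
have absd n : abs (inj (cf_den a n.+1)) * abs (d n) = 1.
  have det := cf_detE a n.
  have dn : abs (inj (cf_den a n) * d n.+1) < 1.
    rewrite absM mulrC; apply: le_lt_trans (cf_approx n.+1 ha yl).
    by rewrite ler_wpM2l ?abs_ge0// ltW// cf_den_lt.
  rewrite -absM; move: dn; set u := inj (cf_den a n) * _; set v := _ * d n.
  have uv : v - u = (-1) ^+ n.+1 by rewrite -det /u /v /d; ring.
  have au : abs (v - u) = 1 by rewrite uv absX absN abs1 expr1n.
  by move=> u1; rewrite -(subrK u v) addrC absD_lt au.
have d0 n : d n != 0.
  by apply: contra_eq_neq (absd n) => ->; rewrite abs0 mulr0 eq_sym oner_eq0.
exists (- d m / d m.+1).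
  have -> : - d m / d m.+1 - inj (a m.+1) = - (d m.+2 / d m.+1).
    by rewrite dS; field.
  rewrite absN absM absV ltr_pdivrMr ?abs_gt0// mul1r.
  rewrite -(ltr_pM2l (x := abs (inj (cf_den a m.+3)))) ?abs_gt0 ?cf_den_neq0//.
  by rewrite absd -(absd m.+1) ltr_pM2r ?abs_gt0// cf_den_lt.
suff : d m.+1 * (- d m / d m.+1) + d m = 0.
  rewrite /d => h; apply/eqP; rewrite -subr_eq0 -h; apply/eqP; ring.
by field.
Qed.

End ContinuedFractions.

(** * Quadratic approximations *)

Section GoldenUnit.
Variables (R : realType) (F : finFieldType) (b : {poly F}).
Hypothesis hb : (1 < size b)%N.
Local Notation abs := (laurent_abs R).
Local Notation inj := (@laurent_of_poly F).

(** The element is [b, b, b, ...]. If the defect y - b - 1/y had size e > 0, a convergent closer to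
    y than min(e, 1), inserted in c_(n+1) = b + 1/c_n, would make the defect smaller than e. *)
Lemma golden_unit_ex :
  exists2 beta : laurent F, abs (beta - inj b) < 1 & beta ^+ 2 = inj b * beta + 1.
Proof.
have ha : cf_coef (fun=> b) by [].
have [y yl] := @cf_limit_ex R F _ ha; exists y.
  by have := cf_approx 1 ha yl; rewrite /= rmorph1 abs1 mul1r mulr1.
have yb : abs (y - inj b) < 1.
  by have := cf_approx 1 ha yl; rewrite /= rmorph1 abs1 mul1r mulr1.
have b1 : 1 < abs (inj b) by rewrite abs_poly_gt1.
have yE : abs y = abs (inj b) by rewrite -[y](subrK (inj b)) absD_lt// (lt_trans yb).
have y0 : y != 0 by rewrite -(abs_gt0 R) yE (lt_trans _ b1).
suff : y - inj b - y^-1 = 0.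
  by move/(congr1 ( *%R y)); rewrite mulr0 !mulrBr divff// => /eqP;
     rewrite !subr_eq add0r -expr2 addrC mulrC [_ * y]mulrC => /eqP.
apply/eqP; rewrite -(abs_eq0 R) eq_le abs_ge0 andbT leNgt; apply/negP => e0.
set e := abs _ in e0; have e1 : 0 < Num.min e 1 by rewrite lt_min e0 ltr01.
have [n yn] := yl _ e1; set c := convergent _ in yn.
have cS : c n.+1 = inj b + (c n)^-1 by [].
have yc : abs (y - c n) < 1 by rewrite (lt_le_trans (yn n _))// ge_min lexx orbT.
have cE : abs (c n) = abs (inj b).
  by rewrite -[c n](subrK y) absD_lt// absBC yE (lt_trans yc).
have c0 : c n != 0 by rewrite -(abs_gt0 R) cE (lt_trans _ b1).
suff : e < e by rewrite ltxx.
rewrite {1}/e; have -> : y - inj b - y^-1 = (y - c n.+1) + (y - c n) / (y * c n).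
  by rewrite cS; field; rewrite y0 c0.
apply: absD_ltr; first by rewrite (lt_le_trans (yn n.+1 _))// ge_min lexx.
rewrite absM absV absM yE cE ltr_pdivrMr; last by rewrite mulr_gt0// (lt_trans _ b1).
rewrite (lt_le_trans (yn n _))// ge_min; apply/orP; left.
by rewrite ler_peMr ?(ltW e0)// mulr_ege1// ltW.
Qed.

(* Dividing r + s beta by the unit beta, or replacing it by its conjugate,
   lowers the degree of s. *)
Lemma norm_form_eq0 (r s : {poly F}) : r ^+ 2 + b * r * s = s ^+ 2 -> s = 0 /\ r = 0.
Proof.
have s0r (t u : {poly F}) : t ^+ 2 + b * t * u = u ^+ 2 -> u = 0 -> t = 0.
  by move=> + u0; rewrite u0 mulr0 addr0 expr0n => /eqP; rewrite expf_eq0 => /eqP.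
move=> E; suff s0 : s = 0 by split=> //; exact: s0r E s0.
have [k sk] := ubnP (size s); elim: k => // k IH in r s E sk *.
apply/eqP/negPn/negP => s0.
(* The pair (s - b t, t) represents (t + s beta) / beta. The claim is applied to t = r and to t = -
   r - b s, which comes from the conjugate of r + s beta up to sign. *)
have descent t : t ^+ 2 + b * t * s = s ^+ 2 -> (size s <= size t)%N.
  move=> Et; rewrite leqNgt; apply/negP => ts.
  have : t = 0.
    apply: (IH (s - b * t) t); last by rewrite (leq_trans ts).
    have -> : (s - b * t) ^+ 2 + b * (s - b * t) * t = s ^+ 2 - b * t * s by ring.
    by rewrite -Et addrK.
  move=> t0; move: Et; rewrite t0 expr0n mulr0 mul0r addr0 => /esym/eqP.
  by rewrite expf_eq0 (negbTE s0).
have E' : (- r - b * s) ^+ 2 + b * (- r - b * s) * s = s ^+ 2 by rewrite -E; ring.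
have [sr sr'] := (descent _ E, descent _ E').
(* Both factors have degree at least deg s and their product is -s^2, so both have degree exactly
   deg s. Their sum -b s has larger degree, a contradiction. *)
have rr' : r * (- r - b * s) = - s ^+ 2 by rewrite -E; ring.
have r0 : r != 0 by rewrite -size_poly_gt0 (leq_trans _ sr)// size_poly_gt0.
have r'0 : - r - b * s != 0 by rewrite -size_poly_gt0 (leq_trans _ sr')// size_poly_gt0.
have b0 : b != 0 by rewrite -size_poly_gt0 (leq_trans _ hb).
have := congr1 (fun f : {poly F} => size f) rr'.
rewrite /= size_polyN size_mul// expr2 size_mul// => szE.
have szbs : size (b * s) = (size b + size s).-1 by rewrite size_mul.
have : (size (b * s)%R <= maxn (size (- r - b * s)%R) (size r))%N.
  have -> : size (b * s) = size (- (- r - b * s) - r).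
    by congr (size (polyseq _)); ring.
  by rewrite (leq_trans (size_polyD _ _))// !size_polyN.
have ss : (0 < size s)%N by rewrite size_poly_gt0.
rewrite szbs leq_max.
suff arith (x y z w : nat) : (x + w).-1 = (z + z).-1 -> (z <= x)%N -> (z <= w)%N ->
    (1 < y)%N -> (0 < z)%N -> ((y + z).-1 <= w)%N || ((y + z).-1 <= x)%N -> False.
  exact: arith szE sr sr' hb ss.
lia.
Qed.

End GoldenUnit.

(** * Moebius images of beta, their quadratic polynomials and their norms *)

Section QuadraticDichotomy.
Variables (R : realType) (F : finFieldType) (b : {poly F}).
Hypothesis hb : (1 < size b)%N.
Variable beta : laurent F.
Local Notation abs := (laurent_abs R).
Local Notation inj := (@laurent_of_poly F).
Hypotheses (beta_b : abs (beta - inj b) < 1)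
  (beta_sq : beta ^+ 2 = inj b * beta + 1).
Local Notation gamma := (inj b - beta).

Lemma abs_beta : abs beta = abs (inj b).
Proof.
by rewrite -[in LHS](subrK (inj b) beta) absD_lt// (lt_trans beta_b)// abs_poly_gt1.
Qed.

Lemma beta_neq0 : beta != 0.
Proof. by rewrite -(abs_gt0 R) abs_beta (lt_trans ltr01)// abs_poly_gt1. Qed.

Lemma beta_conj : gamma = - beta^-1.
Proof.
apply: (mulfI beta_neq0); rewrite mulrN divff ?beta_neq0// mulrBr -expr2 beta_sq.
by rewrite mulrC; ring.
Qed.

Lemma abs_conj : abs gamma = (abs (inj b))^-1.
Proof. by rewrite beta_conj absN absV abs_beta. Qed.

(** Comes from |gamma| < 1 < |beta|, not from the discriminant b^2 + 4, and thus holds in every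
    characteristic. *)
Lemma abs_beta_conj : abs (beta - gamma) = abs (inj b).
Proof.
rewrite absBC absD_lt absN abs_beta// abs_conj.
have b1 : 1 < abs (inj b) by rewrite abs_poly_gt1.
by rewrite (lt_trans _ b1)// invf_lt1// (lt_trans ltr01).
Qed.

Variables p1 p0 q1 q0 : {poly F}.
Hypothesis det : abs (inj p1 * inj q0 - inj p0 * inj q1) = 1.

Let D := inj q1 * beta + inj q0.
Let D' := inj q1 * gamma + inj q0.

(** The two elements are conjugate and their product is the norm form s^2 + b s r - r^2, nonzero by
    [norm_form_eq0]. *)
Lemma mobius_den_neq0 (r s : {poly F}) : (r != 0) || (s != 0) ->
  inj r * beta + inj s != 0 /\ inj r * gamma + inj s != 0.
Proof.
move=> rs; suff : inj (s ^+ 2 + b * s * r - r ^+ 2) != 0.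
  rewrite !(rmorph_nat, rmorphXn, rmorphB, rmorphD, rmorphM).
  have -> : inj s ^+ 2 + inj b * inj s * inj r - inj r ^+ 2 =
    (inj r * beta + inj s) * (inj r * gamma + inj s).
    have -> : (inj r * beta + inj s) * (inj r * gamma + inj s) =
      inj s ^+ 2 + inj b * inj s * inj r - inj r ^+ 2 * (beta ^+ 2 - inj b * beta).
      by ring.
    by rewrite beta_sq; ring.
  by rewrite mulf_eq0 negb_or => /andP.
rewrite laurent_of_poly_eq0 subr_eq0; apply/eqP => /(norm_form_eq0 hb)[r0 s0].
by move: rs; rewrite r0 s0 eqxx.
Qed.

(** Coefficients of the quadratic polynomial with roots [alpha] and [alpha']: the norm of the
    denominator, minus the trace of the numerator times the conjugate denominator, and the norm of
    the numerator, expanded by beta + gamma = b and beta gamma = -1. *)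
Definition quad_lead := q0 ^+ 2 + b * q0 * q1 - q1 ^+ 2.
Definition quad_mid :=
  2 * (p1 * q1) - 2 * (p0 * q0) - b * (p0 * q1 + p1 * q0).
Definition quad_const := p0 ^+ 2 + b * p0 * p1 - p1 ^+ 2.

Let alpha := (inj p1 * beta + inj p0) / D.
Let alpha' := (inj p1 * gamma + inj p0) / D'.

Lemma mobius_den : D != 0 /\ D' != 0.
Proof.
apply: mobius_den_neq0; rewrite -negb_and; apply/negP => /andP[/eqP q1z /eqP q0z].
by move: det; rewrite q1z q0z rmorph0 !mulr0 subrr abs0 => /esym/eqP; rewrite oner_eq0.
Qed.

Lemma quad_leadE : inj quad_lead = D * D'.
Proof.
rewrite /quad_lead !(rmorph_nat, rmorphXn, rmorphB, rmorphD, rmorphM) /D /D'.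
have -> : (inj q1 * beta + inj q0) * (inj q1 * gamma + inj q0) =
   inj q0 ^+ 2 + inj b * inj q0 * inj q1 - inj q1 ^+ 2 * (beta ^+ 2 - inj b * beta).
  by ring.
by rewrite beta_sq; ring.
Qed.

Lemma quad_midE : inj quad_mid = - (inj quad_lead * (alpha + alpha')).
Proof.
have [d0 d0'] := mobius_den.
have -> : inj quad_lead * (alpha + alpha') =
    (inj p1 * beta + inj p0) * D' + (inj p1 * gamma + inj p0) * D.
  by rewrite quad_leadE /alpha /alpha'; field; rewrite d0 d0'.
rewrite /quad_mid !(rmorph_nat, rmorphXn, rmorphB, rmorphD, rmorphM) /D /D'.
have -> : (inj p1 * beta + inj p0) * (inj q1 * gamma + inj q0) +
    (inj p1 * gamma + inj p0) * (inj q1 * beta + inj q0) =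
    2 * (inj p0 * inj q0) + inj b * (inj p0 * inj q1 + inj p1 * inj q0)
    - 2 * (inj p1 * inj q1) * (beta ^+ 2 - inj b * beta).
  by ring.
by rewrite beta_sq; ring.
Qed.

Lemma quad_constE : inj quad_const = inj quad_lead * (alpha * alpha').
Proof.
have [d0 d0'] := mobius_den.
have -> : inj quad_lead * (alpha * alpha') =
    (inj p1 * beta + inj p0) * (inj p1 * gamma + inj p0).
  by rewrite quad_leadE /alpha /alpha'; field; rewrite d0 d0'.
rewrite /quad_const !(rmorph_nat, rmorphXn, rmorphB, rmorphD, rmorphM).
have -> : (inj p1 * beta + inj p0) * (inj p1 * gamma + inj p0) =
   inj p0 ^+ 2 + inj b * inj p0 * inj p1 - inj p1 ^+ 2 * (beta ^+ 2 - inj b * beta).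
  by ring.
by rewrite beta_sq; ring.
Qed.

(** Two images under one Moebius map differ by the determinant times the difference of the
    arguments, over the product of the denominators; that product is [quad_lead]. *)
Lemma abs_root_diff : abs (alpha - alpha') * abs (inj quad_lead) = abs (inj b).
Proof.
have [d0 d0'] := mobius_den.
rewrite -absM quad_leadE.
have -> : (alpha - alpha') * (D * D') =
    (inj p1 * inj q0 - inj p0 * inj q1) * (beta - gamma).
  transitivity ((inj p1 * beta + inj p0) * D' - (inj p1 * gamma + inj p0) * D).
    by rewrite /alpha /alpha'; field; rewrite d0 d0'.
  by rewrite /D /D'; ring.
by rewrite absM det mul1r abs_beta_conj.
Qed.

Lemma root_diff_neq0 : alpha - alpha' != 0.
Proof.
rewrite -(abs_eq0 R); apply: contraTneq (abs_poly_gt1 R hb) => a0.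
by rewrite -abs_root_diff a0 mul0r ltr10.
Qed.

Local Notation ev u v t x := (inj u * x ^+ 2 + inj v * x + inj t).

(* The norm of (q1 beta + q0)^2 (u alpha^2 + v alpha + t) lies in F[T]. *)
Lemma quad_dichotomy (u v t : {poly F}) : [|| u != 0, v != 0 | t != 0] ->
  [/\ inj v = - (inj u * (alpha + alpha')), inj t = inj u * (alpha * alpha') &
      1 <= abs (inj u) * abs (alpha - alpha')] \/
  1 <= abs (inj quad_lead) ^+ 2 * abs (ev u v t alpha) * abs (ev u v t alpha').
Proof.
move=> uvt; have [d0 d0'] := mobius_den.
(* c2 z^2 + c1 z + c0 is the homogenised P at (p1 z + p0, q1 z + q0). The relation z^2 = b z + 1,
   shared by beta and gamma, reduces it to s z + r. *)
pose c2 := u * p1 ^+ 2 + v * p1 * q1 + t * q1 ^+ 2.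
pose c1 := 2 * u * p1 * p0 + v * (p1 * q0 + p0 * q1) + 2 * t * q1 * q0.
pose c0 := u * p0 ^+ 2 + v * p0 * q0 + t * q0 ^+ 2.
pose r := c2 + c0; pose s := b * c2 + c1.
have evE z : z ^+ 2 = inj b * z + 1 -> inj q1 * z + inj q0 != 0 ->
    ev u v t ((inj p1 * z + inj p0) / (inj q1 * z + inj q0)) *
    (inj q1 * z + inj q0) ^+ 2 = inj s * z + inj r.
  move=> zE z0.
  have -> : inj s * z + inj r = inj c2 * z ^+ 2 + inj c1 * z + inj c0.
    have -> : inj s = inj b * inj c2 + inj c1 by rewrite -rmorphM -rmorphD.
    have -> : inj r = inj c2 + inj c0 by rewrite -rmorphD.
    by rewrite zE; ring.
  have -> : inj c2 = inj u * inj p1 ^+ 2 + inj v * inj p1 * inj q1 + inj t * inj q1 ^+ 2.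
    by rewrite /c2 !(rmorph_nat, rmorphXn, rmorphB, rmorphD, rmorphM).
  have -> : inj c1 = 2 * inj u * inj p1 * inj p0 +
      inj v * (inj p1 * inj q0 + inj p0 * inj q1) + 2 * inj t * inj q1 * inj q0.
    by rewrite /c1 !(rmorph_nat, rmorphXn, rmorphB, rmorphD, rmorphM).
  have -> : inj c0 = inj u * inj p0 ^+ 2 + inj v * inj p0 * inj q0 + inj t * inj q0 ^+ 2.
    by rewrite /c0 !(rmorph_nat, rmorphXn, rmorphB, rmorphD, rmorphM).
  by field.
have gE : gamma ^+ 2 = inj b * gamma + 1.
  transitivity (inj b ^+ 2 - inj b * beta + (beta ^+ 2 - inj b * beta)); first by ring.
  by rewrite beta_sq; ring.
have evb : ev u v t alpha * D ^+ 2 = inj s * beta + inj r by exact: evE.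
have evg : ev u v t alpha' * D' ^+ 2 = inj s * gamma + inj r by exact: evE.
clearbody r s.
have [/andP[/eqP sz /eqP rz]|] := boolP ((s == 0) && (r == 0)); last first.
  rewrite negb_and => sr; right; have [s1 s2] := mobius_den_neq0 sr.
  have nE : inj (r ^+ 2 + b * r * s - s ^+ 2) =
      inj quad_lead ^+ 2 * ev u v t alpha * ev u v t alpha'.
    rewrite quad_leadE.
    transitivity ((inj s * beta + inj r) * (inj s * gamma + inj r)).
      rewrite !(rmorph_nat, rmorphXn, rmorphB, rmorphD, rmorphM).
      have -> : (inj s * beta + inj r) * (inj s * gamma + inj r) =
        inj r ^+ 2 + inj b * inj r * inj s - inj s ^+ 2 * (beta ^+ 2 - inj b * beta).
        by ring.
      by rewrite beta_sq; ring.
    by rewrite -evb -evg; ring.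
  rewrite -absX -!absM -nE abs_poly_ge1// subr_eq0; apply/eqP => /(norm_form_eq0 hb)[s0 r0].
  by move: sr; rewrite s0 r0 eqxx.
left; move: evb evg; rewrite sz rz rmorph0 !mul0r addr0 => /eqP.
rewrite mulf_eq0 sqrf_eq0 (negbTE d0) orbF => /eqP ev1.
move=> /eqP; rewrite mulf_eq0 sqrf_eq0 (negbTE d0') orbF => /eqP ev2.
have vE : inj v = - (inj u * (alpha + alpha')).
  apply: (mulfI root_diff_neq0); apply/eqP; rewrite -subr_eq0; apply/eqP.
  transitivity (ev u v t alpha - ev u v t alpha'); first by ring.
  by rewrite ev1 ev2 subrr.
have tE : inj t = inj u * (alpha * alpha').
  apply/eqP; rewrite -subr_eq0; apply/eqP.
  transitivity (ev u v t alpha); last by [].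
  by rewrite vE; ring.
split => //.
have u0 : inj u != 0.
  apply: contraTneq uvt => uz; move: vE tE; rewrite uz !mul0r oppr0 => /eqP + /eqP.
  rewrite !laurent_of_poly_eq0 => /eqP -> /eqP ->; move/eqP: uz.
  by rewrite laurent_of_poly_eq0 => /eqP ->; rewrite eqxx.
(* The discriminant of P lies in F[T] and is nonzero because the two roots differ, so its absolute
   value is at least 1. *)
have disc : inj (v ^+ 2 - 4 * u * t) = (inj u * (alpha - alpha')) ^+ 2.
  by rewrite !(rmorph_nat, rmorphXn, rmorphB, rmorphD, rmorphM) /= vE tE; ring.
rewrite -absM -(@ler_pXn2r _ 2) ?nnegrE ?abs_ge0// expr1n -absX -disc abs_poly_ge1//.
by rewrite -laurent_of_poly_eq0 disc sqrf_eq0 mulf_neq0// root_diff_neq0.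
Qed.

End QuadraticDichotomy.

(* With m < N consecutive positions of the partial quotient c, alpha is
   [0, a_1, ..., a_m, b, b, ...], alpha' its conjugate, f2 z^2 + f1 z + f0 their
   polynomial, X = |q_m| and Y = |q_N|. *)
Record quad_approx (R : realType) (F : finFieldType) (y : laurent F) (C X Y : R)
    (f0 f1 f2 : {poly F}) (alpha alpha' : laurent F) : Prop := QuadApprox {
  qa_mid : laurent_of_poly f1 = - (laurent_of_poly f2 * (alpha + alpha'));
  qa_const : laurent_of_poly f0 = laurent_of_poly f2 * (alpha * alpha');
  qa_f2_ge : C^-1 * X ^+ 2 <= laurent_abs R (laurent_of_poly f2);
  qa_f2_le : laurent_abs R (laurent_of_poly f2) <= C * X ^+ 2;
  qa_f1_le : laurent_abs R (laurent_of_poly f1) <= C * X ^+ 2;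
  qa_f0_le : laurent_abs R (laurent_of_poly f0) <= C * X ^+ 2;
  qa_root_ge : C^-1 * Y ^- 2 <= laurent_abs R (y - alpha);
  qa_root_le : laurent_abs R (y - alpha) <= C * Y ^- 2;
  qa_conj_ge : C^-1 * X ^- 2 <= laurent_abs R (y - alpha');
  qa_conj_le : laurent_abs R (y - alpha') <= C * X ^- 2;
  qa_irrational : forall r s : {poly F}, (r != 0) || (s != 0) ->
    laurent_of_poly r * alpha + laurent_of_poly s != 0;
  qa_dichotomy : forall u v t : {poly F}, [|| u != 0, v != 0 | t != 0] ->
    [/\ laurent_of_poly v = - (laurent_of_poly u * (alpha + alpha')),
        laurent_of_poly t = laurent_of_poly u * (alpha * alpha') &
        C^-1 * X ^+ 2 <= laurent_abs R (laurent_of_poly u)] \/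
    1 <= (C * X ^+ 2) ^+ 2 *
      laurent_abs R (laurent_of_poly u * alpha ^+ 2 + laurent_of_poly v * alpha
                     + laurent_of_poly t) *
      laurent_abs R (laurent_of_poly u * alpha' ^+ 2 + laurent_of_poly v * alpha'
                     + laurent_of_poly t) }.

(** * The quadratic approximation attached to two consecutive positions of c *)

Section QuadraticApproximation.
Variables (R : realType) (F : finFieldType) (b c : {poly F}).
Hypotheses (hb : (1 < size b)%N) (hc : (1 < size c)%N) (hbc : b <> c).
Local Notation abs := (laurent_abs R).
Local Notation inj := (@laurent_of_poly F).
Variables (a : nat -> {poly F}) (y : laurent F).
Hypotheses (ha : cf_coef a) (yl : cf_limit R a y) (a0 : a 0%N = 0).
Variable beta : laurent F.
Hypotheses (beta_b : abs (beta - inj b) < 1)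
  (beta_sq : beta ^+ 2 = inj b * beta + 1).
Local Notation gamma := (inj b - beta).

Let P n := inj (cf_num a n).
Let Q n := inj (cf_den a n).

(** The factor |b - c| measures the gap between xi and alpha where their expansions part; it also
    enters the size of the conjugate denominator. *)
Definition cf_const : R := abs (inj b) * abs (inj c) * abs (inj b - inj c).

Let B := abs (inj b).
Let Cc := abs (inj c).
Let E := abs (inj b - inj c).

Let B1 : 1 < B. Proof. exact: abs_poly_gt1. Qed.
Let Cc1 : 1 < Cc. Proof. exact: abs_poly_gt1. Qed.
Let E1 : 1 <= E.
Proof. by rewrite /E -rmorphB abs_poly_ge1// subr_eq0; apply/eqP. Qed.

Let B0 : 0 < B. Proof. exact: lt_trans B1. Qed.
Let Cc0 : 0 < Cc. Proof. exact: lt_trans Cc1. Qed.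
Let E0 : 0 < E. Proof. exact: lt_le_trans E1. Qed.

Let abs_betaE : abs beta = B. Proof. exact: abs_beta. Qed.

Lemma cf_abs_lt1 : abs y < 1.
Proof. by have := cf_approx 1 ha yl; rewrite /= a0 rmorph0 rmorph1 mul1r abs1 mulr1 subr0. Qed.

Lemma cf_num_le n : abs (P n.+1) <= abs (Q n.+1).
Proof.
have Q1 : 1 <= abs (Q n.+1).
  by rewrite (le_trans _ (cf_den_ge R n ha))// exprn_ege1// ltW// card_gt1.
have -> : P n.+1 = Q n.+1 * y - (Q n.+1 * y - P n.+1) by ring.
apply: absB_le.
  by rewrite absM ler_piMr ?abs_ge0// ltW// cf_abs_lt1.
have := cf_approx n.+1 ha yl; rewrite -/(Q _) -/(P _) => /ltW h.
rewrite (le_trans _ Q1)// (le_trans _ h)// ler_peMr ?abs_ge0//.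
Qed.

Let abs_mobius_den m z : 1 < abs z ->
  abs (Q m.+1 * z + Q m) = abs (Q m.+1) * abs z.
Proof.
move=> z1; rewrite addrC absD_lt absM// (lt_trans (cf_den_lt R m ha))//.
by rewrite ltr_pMr// abs_gt0 cf_den_neq0.
Qed.

Let abs_den_beta m : abs (Q m.+1 * beta + Q m) = abs (Q m.+1) * B.
Proof. by rewrite abs_mobius_den abs_betaE. Qed.

Let root m := (P m.+1 * beta + P m) / (Q m.+1 * beta + Q m).

(** Since beta = b + 1/beta, a further quotient b multiplies numerator and denominator by beta.
    Hence alpha may be written at any level from m to N - 1, in particular just before xi leaves
    it. *)
Let rootS m : a m.+1 = b -> root m.+1 = root m.
Proof.
move=> am; have be0 : beta != 0 by exact: (beta_neq0 hb beta_b).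
have Q0 k : Q k.+1 * beta + Q k != 0.
  by rewrite -(abs_gt0 R) abs_den_beta mulr_gt0// abs_gt0 cf_den_neq0.
have numE : P m.+2 * beta + P m.+1 = beta * (P m.+1 * beta + P m).
  rewrite /P cf_numS am rmorphD rmorphM.
  transitivity (P m.+1 * (inj b * beta + 1) + beta * P m); first by rewrite /P; ring.
  by rewrite -beta_sq /P; ring.
have denE : Q m.+2 * beta + Q m.+1 = beta * (Q m.+1 * beta + Q m).
  rewrite /Q cf_denS am rmorphD rmorphM.
  transitivity (Q m.+1 * (inj b * beta + 1) + beta * Q m); first by rewrite /Q; ring.
  by rewrite -beta_sq /Q; ring.
by rewrite /root numE denE -mulf_div divff// mul1r.
Qed.

Variables m N : nat.
Hypotheses (m0 : (0 < m)%N) (mN : (m.+1 < N)%N) (am : a m = c) (aN : a N = c)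
  (amN : forall k, (m < k < N)%N -> a k = b).

Let X := abs (Q m.+1).
Let Y := abs (Q N.+1).
Let D := Q m.+1 * beta + Q m.
Let D' := Q m.+1 * gamma + Q m.
Let alpha := root m.
Let alpha' := (P m.+1 * gamma + P m) / D'.

Let X0 : 0 < X. Proof. by rewrite abs_gt0 cf_den_neq0. Qed.
Let Y0 : 0 < Y. Proof. by rewrite abs_gt0 cf_den_neq0. Qed.

Let det k : abs (P k.+1 * Q k - P k * Q k.+1) = 1.
Proof. by rewrite cf_detE absX absN abs1 expr1n. Qed.

Let abs_den : abs D = X * B.
Proof. exact: abs_den_beta. Qed.

Let beta_c : abs (beta - inj c) = E.
Proof.
have -> : beta - inj c = (beta - inj b) + (inj b - inj c) by rewrite addrA subrK.
by rewrite absD_lt// (lt_le_trans beta_b).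
Qed.

(** The two terms of [D'] have equal size when deg b = deg c and might cancel. Inserting a_m = c and
    gamma = -1/beta rewrites [D'] with the factor beta - c, whose size |b - c| is known. *)
Let abs_den_conj : abs D' = E / (B * Cc) * X.
Proof.
have be0 : beta != 0 by exact: (beta_neq0 hb beta_b).
have -> : D' = ((beta - inj c) * Q m - Q m.-1) / beta.
  rewrite /D' (beta_conj hb beta_b beta_sq) -{1 2}(prednK m0) /Q cf_denS.
  by rewrite (prednK m0) am rmorphD rmorphM; field.
have XE : X = Cc * abs (Q m).
  by rewrite /X /Q -{1}(prednK m0) abs_cf_denS// (prednK m0) am.
have Qm : abs (Q m.-1) < abs (Q m) by rewrite -{2}(prednK m0) cf_den_lt.
rewrite absM absV abs_betaE addrC absD_lt.
  by rewrite absM beta_c XE; field; rewrite !gt_eqF// (lt_trans ltr01).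
by rewrite absN absM beta_c (lt_le_trans Qm)// ler_peMl ?abs_ge0.
Qed.

Let C_gt0 : 0 < B * Cc * E.
Proof. by rewrite !mulr_gt0// (lt_trans ltr01)// (lt_le_trans ltr01). Qed.

(* Every constant met below is a product of powers of B, Cc and E with exponents
   in [-1, 1], so that B Cc E bounds it and its inverse. *)
Let const_le (e f g : int) : e <= 1 -> f <= 1 -> g <= 1 ->
  B ^ e * Cc ^ f * E ^ g <= B * Cc * E.
Proof.
have p1 (x : R) (k : int) : 1 <= x -> k <= 1 -> x ^ k <= x.
  by move=> x1 k1; rewrite -[leRHS]expr1z ler_weXz2l.
have p0 (x : R) (k : int) : 1 <= x -> 0 <= x ^ k.
  by move=> x1; rewrite exprz_ge0// (le_trans ler01).
by move=> e1 f1 g1; rewrite ?ler_pM// ?mulr_ge0// ?p1// ?p0// ltW.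
Qed.

Let const_ge (e f g : int) : -1 <= e -> -1 <= f -> -1 <= g ->
  (B * Cc * E)^-1 <= B ^ e * Cc ^ f * E ^ g.
Proof.
move=> e1 f1 g1; rewrite invf_ple ?posrE// ?mulr_gt0 ?exprz_gt0//.
by rewrite !invfM !invr_expz const_le// lerNl.
Qed.

Let absA : abs (inj (quad_lead b (cf_den a m.+1) (cf_den a m))) = E / Cc * X ^+ 2.
Proof.
rewrite (quad_leadE beta_sq) absM abs_den -/D' abs_den_conj.
by field; rewrite !gt_eqF// (lt_trans ltr01).
Qed.

(** y is the image of its complete quotient z under a Moebius map of determinant 1 or -1, so
    distances from y are read off at the level of complete quotients. *)
Let mobius_diff k z w :
  y * (Q k.+1 * z + Q k) = P k.+1 * z + P k -> Q k.+1 * w + Q k != 0 ->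
  abs (y - (P k.+1 * w + P k) / (Q k.+1 * w + Q k)) *
    (abs (Q k.+1 * z + Q k) * abs (Q k.+1 * w + Q k)) = abs (z - w).
Proof.
move=> yE w0; rewrite -!absM.
have -> : (y - (P k.+1 * w + P k) / (Q k.+1 * w + Q k)) *
    ((Q k.+1 * z + Q k) * (Q k.+1 * w + Q k)) =
    (y * (Q k.+1 * z + Q k)) * (Q k.+1 * w + Q k)
    - (P k.+1 * w + P k) * (Q k.+1 * z + Q k) by field.
rewrite yE.
have -> : (P k.+1 * z + P k) * (Q k.+1 * w + Q k) -
    (P k.+1 * w + P k) * (Q k.+1 * z + Q k) =
    (P k.+1 * Q k - P k * Q k.+1) * (z - w) by ring.
by rewrite absM det mul1r.
Qed.

Let root_const k : (m <= k < N)%N -> root k = alpha.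
Proof.
elim: k => [|k IH]; first by case: m m0.
case/andP; rewrite leq_eqVlt => /predU1P[<- //|]; rewrite ltnS => mk kN.
by rewrite rootS ?IH ?mk ?(ltnW kN)// amN// ltnS mk.
Qed.

(** At index N the complete quotient of y is close to c, while that of alpha is beta, which is close
    to b; they are |b - c| apart. *)
Let abs_root : abs (y - alpha) = E * Cc / B * Y ^- 2.
Proof.
have Npred : N = N.-1.+1 by case: N mN.
have mN1 : (m <= N.-1 < N)%N by move: mN; case: N => // n; rewrite /= ltnS leqnn => /ltnW ->.
rewrite -(root_const mN1).
have [z zc yz] := complete_quotient N.-1 ha yl.
rewrite -Npred aN in zc yz.
have zE : abs z = Cc.
  by rewrite -[z](subrK (inj c)) absD_lt// (lt_trans zc).
have := mobius_diff (k := N.-1) (z := z) (w := beta).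
rewrite -Npred => /(_ yz); rewrite /root -Npred.
have QN : 0 < abs (Q N) by rewrite Npred abs_gt0 cf_den_neq0.
have den := abs_den_beta N.-1; rewrite -Npred in den.
have den0 : Q N * beta + Q N.-1 != 0 by rewrite -(abs_gt0 R) den mulr_gt0.
move=> /(_ den0); rewrite den.
have -> : abs (Q N * z + Q N.-1) = abs (Q N) * Cc.
  by have := @abs_mobius_den N.-1 z; rewrite -Npred zE; apply.
have -> : abs (z - beta) = E.
  have -> : z - beta = (z - inj c) + (inj c - beta) by rewrite addrA subrK.
  by rewrite absD_lt absBC// beta_c (lt_le_trans zc).
have -> : Y = Cc * abs (Q N) by rewrite /Y /Q Npred abs_cf_denS// -Npred aN.
move=> <-; field; rewrite !gt_eqF//.
Qed.

(** Compared at index m + 1: there y has a complete quotient close to b, because [mN] leaves at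
    least one b after position m, whereas gamma has absolute value less than 1. *)
Let abs_root_conj : abs (y - alpha') = B * Cc / E * X ^- 2.
Proof.
have [z zb yz] := complete_quotient m ha yl.
have amS : a m.+1 = b by rewrite amN// ltnSn.
rewrite amS in zb.
have zE : abs z = B.
  by rewrite -[z](subrK (inj b)) absD_lt// (lt_trans zb).
have D'0 : D' != 0.
  by rewrite -(abs_gt0 R) abs_den_conj !(mulr_gt0, invr_gt0).
have := mobius_diff yz D'0; rewrite abs_mobius_den zE// abs_den_conj.
have -> : abs (z - gamma) = B.
  rewrite addrC absD_lt zE// absN (abs_conj hb beta_b beta_sq).
  by rewrite (lt_trans _ B1)// invf_lt1.
move=> h; apply: (mulIf (x := X * B * (E / (B * Cc) * X))).
  by rewrite !mulf_neq0 ?invr_neq0 ?mulf_neq0 ?gt_eqF.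
by rewrite h; field; rewrite !gt_eqF.
Qed.

Lemma quad_approxP : quad_approx y cf_const X Y
  (quad_const b (cf_num a m.+1) (cf_num a m))
  (quad_mid b (cf_num a m.+1) (cf_num a m) (cf_den a m.+1) (cf_den a m))
  (quad_lead b (cf_den a m.+1) (cf_den a m)) alpha alpha'.
Proof.
have nz : (B != 0) * (Cc != 0) * (E != 0) * (X != 0) * (Y != 0).
  by rewrite !gt_eqF// ?(lt_trans ltr01)// (lt_le_trans ltr01).
have sq0 : 0 < X ^+ 2 by rewrite exprn_gt0.
have Xm : abs (Q m) <= X by rewrite ltW// cf_den_lt.
have Pm : abs (P m) <= X by rewrite (le_trans _ Xm)// -(prednK m0) cf_num_le.
have P1 : abs (P m.+1) <= X by exact: cf_num_le.
have two : abs (2 : laurent F) <= 1 by rewrite absD_le ?abs1.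
have bX2 : B * X ^+ 2 <= cf_const * X ^+ 2.
  rewrite ler_pM2r//; have := const_le (e := 1) (f := 0) (g := 0).
  by rewrite !expr0z !mulr1 expr1z; apply.
have X2b : X ^+ 2 <= B * X ^+ 2 by rewrite ler_peMl// ltW.
have pqX (x z : laurent F) : abs x <= X -> abs z <= X -> abs (x * z) <= X ^+ 2.
  by move=> xX zX; rewrite absM expr2 ler_pM ?abs_ge0.
have twoX (x z : laurent F) : abs x <= X -> abs z <= X -> abs (2 * (x * z)) <= B * X ^+ 2.
  move=> xX zX; rewrite absM (le_trans _ X2b)// (le_trans _ (pqX _ _ xX zX))//.
  by rewrite ler_piMl ?abs_ge0.
have bpqX (x z : laurent F) : abs x <= X -> abs z <= X -> abs (inj b * (x * z)) <= B * X ^+ 2.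
  by move=> xX zX; rewrite absM ler_pM2l ?pqX// (lt_trans ltr01).
have c1 : E / Cc = B ^ 0 * Cc ^ (-1) * E ^ 1.
  by rewrite expr0z mul1r expr1z exprN1 mulrC.
have c2 : E * Cc / B = B ^ (-1) * Cc ^ 1 * E ^ 1 by rewrite !expr1z exprN1; ring.
have c3 : B * Cc / E = B ^ 1 * Cc ^ 1 * E ^ (-1) by rewrite !expr1z exprN1.
have c4 : E / (B * Cc) = B ^ (-1) * Cc ^ (-1) * E ^ 1.
  by rewrite !expr1z !exprN1 invfM mulrC.
split.
- exact: (quad_midE hb beta_sq (det m)).
- exact: (quad_constE hb beta_sq (det m)).
- by rewrite absA ler_pM2r// c1 const_ge.
- by rewrite absA ler_pM2r// c1 const_le.
- apply: le_trans bX2; rewrite /quad_mid.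
  rewrite !(rmorph_nat, rmorphXn, rmorphB, rmorphD, rmorphM) /= !mulrDr.
  have Q1 : abs (Q m.+1) <= X by [].
  exact: (absB_le (absB_le (twoX _ _ P1 Q1) (twoX _ _ Pm Xm))
                  (absD_le (bpqX _ _ Pm Q1) (bpqX _ _ P1 Xm))).
- apply: le_trans bX2; rewrite /quad_const.
  rewrite !(rmorph_nat, rmorphXn, rmorphB, rmorphD, rmorphM) /= !expr2.
  rewrite -mulrA; apply: absB_le; last exact: le_trans (pqX _ _ P1 P1) X2b.
  exact: absD_le (le_trans (pqX _ _ Pm Pm) X2b) (bpqX _ _ Pm P1).
- by rewrite abs_root ler_pM2r ?invr_gt0 ?exprn_gt0// c2 const_ge.
- by rewrite abs_root ler_pM2r ?invr_gt0 ?exprn_gt0// c2 const_le.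
- by rewrite abs_root_conj ler_pM2r ?invr_gt0 ?exprn_gt0// c3 const_ge.
- by rewrite abs_root_conj ler_pM2r ?invr_gt0 ?exprn_gt0// c3 const_le.
(* Over the denominator D, the value r alpha + s becomes a form in beta whose coefficients arise
   from (r, s) by a matrix of determinant 1 or -1, so they do not both vanish. *)
- move=> r s rs; have D0 : D != 0 by rewrite -(abs_gt0 R) abs_den mulr_gt0.
  have -> : inj r * alpha + inj s =
      (inj (r * cf_num a m.+1 + s * cf_den a m.+1) * beta +
       inj (r * cf_num a m + s * cf_den a m)) / D.
    rewrite !rmorphD !rmorphM /= -/(P _) -/(P _) -/(Q _) -/(Q _) /alpha /root -/D.
    by rewrite -[inj s](mulfK D0) {2}/D; field.
  rewrite mulf_neq0 ?invr_neq0//; apply: (mobius_den_neq0 hb beta_sq _).1.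
  rewrite -negb_and; apply: contraL rs => /andP[/eqP e1 /eqP e2].
  have rd : inj r * (P m.+1 * Q m - P m * Q m.+1) =
      inj (r * cf_num a m.+1 + s * cf_den a m.+1) * Q m -
      inj (r * cf_num a m + s * cf_den a m) * Q m.+1.
    by rewrite !rmorphD !rmorphM /P /Q; ring.
  have sd : inj s * (P m.+1 * Q m - P m * Q m.+1) =
      inj (r * cf_num a m + s * cf_den a m) * P m.+1 -
      inj (r * cf_num a m.+1 + s * cf_den a m.+1) * P m.
    by rewrite !rmorphD !rmorphM /P /Q; ring.
  have det0 : P m.+1 * Q m - P m * Q m.+1 != 0 by rewrite -(abs_gt0 R) det.
  move/eqP: rd; move/eqP: sd; rewrite e1 e2 rmorph0 !mul0r subrr !mulf_eq0.
  by rewrite (negbTE det0) !orbF !laurent_of_poly_eq0 => -> ->.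
- move=> u v t /(quad_dichotomy hb beta_b beta_sq (det m))[[vE tE u1]|h].
    left; split; [exact: vE|exact: tE|]; have := abs_root_diff hb beta_b beta_sq (det m).
    rewrite absA -/B => rd.
    have rdE : abs (alpha - alpha') = B * Cc / (E * X ^+ 2).
      apply: (mulIf (x := E / Cc * X ^+ 2)).
        by rewrite !mulf_neq0 ?invr_neq0 ?expf_neq0 ?gt_eqF.
      by rewrite rd; field; rewrite !gt_eqF.
    apply: (@le_trans _ _ (E / (B * Cc) * X ^+ 2)).
      by rewrite ler_pM2r// c4 const_ge.
    move: u1; rewrite -/alpha -/D' -/alpha' rdE -ler_pdivrMr ?mulr_gt0 ?invr_gt0 ?mulr_gt0//.
    by rewrite mul1r invf_div mulrAC.
  right; apply: le_trans h _; rewrite absA.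
  do 2!(apply: ler_wpM2r; first exact: abs_ge0).
  have AC : E / Cc * X ^+ 2 <= cf_const * X ^+ 2 by rewrite ler_pM2r// c1 const_le.
  have A0 : 0 <= E / Cc * X ^+ 2 by rewrite -absA abs_ge0.
  by rewrite lerXn2r ?nnegrE// (le_trans A0).
Qed.

End QuadraticApproximation.

(** * Growth of the denominators *)

Lemma limn_esup_eq (R : realType) (u : nat -> R) (l : R) :
  (forall e : R, 0 < e -> exists N, forall n, (N <= n)%N -> u n <= l + e) ->
  (forall (e : R) N, 0 < e -> exists2 n, (N <= n)%N & l - e <= u n) ->
  limn_esup (fun n => (u n)%:E) = l%:E.
Proof.
move=> ub lb; apply/eqP; rewrite eq_le; apply/andP; split.
  apply/lee_addgt0Pr => e /ub[N uN]; apply: ge_ereal_inf.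
  exists (ereal_sup ((fun n => (u n)%:E) @` [set n | (N <= n)%N])).
    by exists [set n | (N <= n)%N] => //; exact: nbhs_infty_ge.
  by apply: ge_ereal_sup => _ [n /= Nn <-]; rewrite -EFinD lee_fin uN.
apply/ereal_infP => _ [V [N _ NV] <-]; apply/lee_addgt0Pr => e e0.
have [n Nn un] := lb e N e0.
apply: (@le_trans _ _ ((u n)%:E + e%:E)%E).
  by rewrite -EFinD lee_fin -lerBlDr.
by rewrite leeD2r// ereal_sup_ubound//; exists n => //; exact: NV.
Qed.

Definition tends_to_infty (R : realType) (x : nat -> R) :=
  forall M : R, exists J, forall j, (J <= j)%N -> M <= x j.

Definition ratio_tends_to (R : realType) (w : R) (x : nat -> R) :=
  forall e : R, 0 < e ->
  exists J, forall j, (J <= j)%N -> `|x j.+1 - w * x j| <= e * x j.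

Section Growth.
Variables (R : realType) (w K : R) (x : nat -> R).
Hypotheses (w_gt : 9 / 2 < w) (w_quad : 0 <= w ^+ 2 - 5 * w + 2) (K0 : 0 <= K).
Hypotheses (x_ge0 : forall j, 0 <= x j) (xw : ratio_tends_to w x)
  (xoo : tends_to_infty x).

(* The level is the least j with K + h + x_j < x_(j+1); minimality bounds
   x_j by about w/(w-1) h, and 1 + 2w/(w-1) <= w - 1 is w^2 - 5w + 2 >= 0. *)
Lemma choose_level (e : R) : 0 < e -> exists h0 : R, forall h : R, h0 <= h -> exists j,
  [/\ K + h + x j < x j.+1, K + h + 2 * x j <= (w - 1 + e) * h &
      2 * x j <= h + K -> K + 2 * x j.+1 <= (w + e) * h].
Proof.
move: (w_gt) (w_quad) (K0) => w45 wq K_ge0 e0; pose d := Num.min (1 / 2) (e / 2).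
have d0 : 0 < d by rewrite lt_min; apply/andP; split; lra.
have d12 : d <= 1 / 2 by rewrite ge_min lexx.
have de : d <= e / 2 by rewrite ge_min lexx orbT.
have [J xJ] := xw d0.
have xlu j : (J <= j)%N -> (w - d) * x j <= x j.+1 /\ x j.+1 <= (w + d) * x j.
  by move=> /xJ; rewrite ler_norml => /andP[]; lra.
(* S pushes the level beyond J, where the ratio estimate is available: if h >= S, no j <= J
   satisfies K + h + x_j < x_(j+1). *)
have [S [S0 SJ]] : exists S : R, 0 <= S /\ forall j, (j <= J)%N -> x j.+1 <= S.
  exists (\sum_(i < J.+1) x i.+1); split=> [|j jJ]; first exact: sumr_ge0.
  by rewrite (bigD1 (Ordinal (jJ : (j < J.+1)%N)))//= lerDl sumr_ge0.
have w2 : 0 <= 2 * (w + 2) by lra.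
(* T makes h so large that e h / 2 absorbs the multiples of K left over at the end. *)
have [T [T0 TE]] : exists T : R, 0 <= T /\ T * e = 2 * (w + 2) * K.
  exists (2 * (w + 2) * K / e); split; last by rewrite divfK// gt_eqF.
  by apply: divr_ge0; [exact: mulr_ge0|exact: ltW].
exists (S + T) => h hge; have hS : S <= h by lra.
have h0 : 0 <= h by lra.
have hK : (w + 2) * K <= (e - d) * h.
  have : T * e <= h * e by rewrite ler_wpM2r ?(ltW e0)//; lra.
  have : e / 2 * h <= (e - d) * h by rewrite ler_wpM2r//; lra.
  lra.
have ex : exists j, K + h + x j < x j.+1.
  have [J' xJ'] := xoo (K + h + 1); exists (maxn J J').
  have [l _] := xlu _ (leq_maxl J J'); have := xJ' _ (leq_maxr J J').
  move: l; set y := x (maxn J J') => l yb.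
  have y0 : 0 <= y by exact: x_ge0.
  have : 3 * y <= (w - d - 1) * y by rewrite ler_wpM2r//; lra.
  lra.
case: (ex_minnP ex) => j jP jmin; exists j.
have Jj : (J < j)%N.
  rewrite ltnNge; apply/negP => jJ; move: jP; apply/negP; rewrite -leNgt.
  by have := SJ _ jJ; have := x_ge0 j; lra.
case: j Jj jP jmin => // j Jj jP jmin.
have [l _] := xlu j Jj; have [_ u] := xlu j.+1 (ltnW Jj).
have prev : x j.+1 <= K + h + x j.
  by rewrite leNgt; apply/negP => /jmin; rewrite ltnn.
have xb : 2 * x j.+1 <= (w - 2 + d) * (K + h).
  have Kh : 0 <= K + h by lra.
  have w1 : 0 < w - d - 1 by lra.
  rewrite -(ler_pM2l w1).
  have l1 : (w - d - 1) * (2 * x j.+1) <= 2 * (w - d) * (K + h).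
    have : (w - d) * x j.+1 <= (w - d) * (K + h + x j) by rewrite ler_wpM2l//; lra.
    lra.
  (* The difference (w - d - 1)(w - 2 + d) - 2(w - d) equals (w^2 - 5 w + 2) + d (3 - d); this is
     where the quadratic inequality for w is spent. *)
  apply: le_trans l1 _; rewrite mulrA ler_wpM2r//.
  have : 0 <= d * (3 - d) by rewrite mulr_ge0//; lra.
  lra.
split => //.
  have : d * K <= K by rewrite ler_piMl//; lra.
  lra.
move=> xh.
have : (w + d) * (2 * x j.+1) <= (w + d) * (h + K) by rewrite ler_wpM2l//; lra.
have : d * K <= K by rewrite ler_piMl//; lra.
lra.
Qed.

Lemma ratio_lower (e : R) : 0 < e -> exists J, forall j, (J <= j)%N ->
  (w - e) * (2 * x j + K) <= 2 * x j.+1 - K.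
Proof.
move: (w_gt) (K0) => w45 K_ge0 e0; have [J1 h1] := xw (divr_gt0 e0 (ltr0Sn _ 1)).
have [J2 h2] := xoo ((1 + w) * K / e); exists (maxn J1 J2) => j.
rewrite geq_max => /andP[/h1 + /h2]; rewrite ler_norml ler_pdivrMr// => /andP[+ _].
have : 0 <= e * K by rewrite mulr_ge0// ltW.
lra.
Qed.

End Growth.

(** * The positions of c and the resulting growth of log X_j *)

Section FloorPowers.
Variables (R : realType) (w : R).
Hypothesis w_gt : 9 / 2 < w.

Definition floor_pow (j : nat) : nat := `|Num.floor (w ^+ j)|%N.

Let wX_ge1 j : 1 <= w ^+ j. Proof. by have w45 := w_gt; rewrite exprn_ege1//; lra. Qed.

Lemma floor_powE j : (floor_pow j)%:Z = Num.floor (w ^+ j).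
Proof. by rewrite /floor_pow gez0_abs// floor_ge0 (le_trans ler01). Qed.

Lemma floor_pow_itv j : (floor_pow j)%:R <= w ^+ j < (floor_pow j)%:R + 1.
Proof.
by have := floor_itv (w ^+ j); rewrite -floor_powE intrD.
Qed.

Lemma floor_pow0 : floor_pow 0 = 1%N.
Proof. by rewrite /floor_pow expr0 floor1. Qed.

(** Guarantees a quotient b between two consecutive quotients c, as the size of the conjugate
    distance requires. *)
Lemma floor_powS j : ((floor_pow j).+1 < floor_pow j.+1)%N.
Proof.
have w45 := w_gt; rewrite -ltnS -(ltr_nat R) -addn2 natrD.
have /andP[_] := floor_pow_itv j.+1; have /andP[+ _] := floor_pow_itv j.
rewrite -natr1 exprS; have := wX_ge1 j => w1.
have : 9 / 2 * w ^+ j <= w * w ^+ j by rewrite ler_wpM2r//; lra.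
lra.
Qed.

Lemma floor_pow_lt i j : (i < j)%N -> (floor_pow i < floor_pow j)%N.
Proof.
elim: j => // j IH; rewrite ltnS leq_eqVlt => /predU1P[->|/IH ij].
  exact: ltnW (floor_powS j).
exact: ltn_trans ij (ltnW (floor_powS j)).
Qed.

(** Quadratic growth is all that is needed: the error terms to be absorbed later are linear in j. *)
Lemma floor_pow_ge j : (j.+1 ^ 2 <= floor_pow j)%N.
Proof.
have w45 := w_gt; apply: (@leq_trans (4 ^ j)).
  by rewrite -[4%N]/(2 ^ 2)%N -expnM mulnC expnM leq_exp2r// ltn_expl.
rewrite -lez_nat floor_powE floor_ge_int.
rewrite -[(4 ^ j)%N%:~R]/((4 ^ j)%N%:R : R) natrX lerXn2r ?nnegrE//; lra.
Qed.

Lemma partial_quotient_pow (F : finFieldType) (b c : {poly F}) j :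
  partial_quotient w b c (floor_pow j) = c.
Proof.
rewrite /partial_quotient; have : (0 < floor_pow j)%N.
  by rewrite (leq_trans _ (floor_pow_ge j)).
case: (floor_pow j) (floor_powE j) => // n nE _ /=.
by rewrite asboolT//; exists j.
Qed.

Lemma partial_quotient_gap (F : finFieldType) (b c : {poly F}) j k :
  (floor_pow j < k < floor_pow j.+1)%N ->
  partial_quotient w b c k = b.
Proof.
case/andP=> jk kj; rewrite /partial_quotient ifF; last by case: k jk {kj}.
rewrite asboolF// => -[i]; rewrite -floor_powE => -[ki].
move: jk kj; rewrite ki; have [ij|ji|<-] := ltngtP i j; last by rewrite ltnn.
  by rewrite ltnNge ltnW// floor_pow_lt.
move: ji; rewrite leq_eqVlt => /predU1P[<-|/floor_pow_lt h _].
  by rewrite ltnn.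
by rewrite ltnNge ltnW.
Qed.

Variables (A B : R) (x : nat -> R).
Hypotheses (A0 : 0 < A) (B0 : 0 < B) (x0 : x 0%N = B).
Hypothesis xS : forall j,
  x j.+1 = x j + (floor_pow j.+1 - floor_pow j - 1)%:R * A + B.

(** With A = log |b| and B = log |c|: among the first n_j partial quotients exactly j + 1 equal
    c. *)
Lemma floor_pow_sumE j : x j = (floor_pow j)%:R * A + j.+1%:R * (B - A).
Proof.
elim: j => [|j IH]; first by rewrite x0 floor_pow0; lra.
have h := floor_powS j.
have d1 : (floor_pow j.+1 - floor_pow j - 1)%:R =
    (floor_pow j.+1)%:R - (floor_pow j)%:R - 1 :> R.
  by rewrite natrB ?natrB ?subn_gt0// ltnW// ltnW.
have d2 : j.+2%:R = j.+1%:R + 1 :> R by rewrite -[j.+2]addn1 natrD.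
by rewrite xS IH d1 d2; ring.
Qed.

Let kappa := Num.min A B.

Let kappa_gt0 : 0 < kappa. Proof. by rewrite lt_min A0. Qed.

Lemma floor_pow_sum_ge j : j.+1%:R ^+ 2 * kappa <= x j.
Proof.
have nj : (j.+1 <= floor_pow j)%N.
  by rewrite (leq_trans _ (floor_pow_ge j))// expnS expn1 leq_pmulr.
apply: (@le_trans _ _ ((floor_pow j)%:R * kappa)).
  by rewrite -natrX ler_wpM2r ?(ltW kappa_gt0)// ler_nat floor_pow_ge.
rewrite floor_pow_sumE.
have -> : (floor_pow j)%:R = (floor_pow j - j.+1)%:R + j.+1%:R :> R.
  by rewrite -natrD subnK.
have kA : kappa <= A by rewrite ge_min lexx.
have kB : kappa <= B by rewrite ge_min lexx orbT.
set u := _%:R; set v := _%:R.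
have : u * kappa <= u * A by rewrite ler_wpM2l.
have : v * kappa <= v * B by rewrite ler_wpM2l.
lra.
Qed.

Lemma floor_pow_sum_infty : tends_to_infty x.
Proof.
move=> M; exists (Num.truncn (M / kappa)) => j Jj.
apply: le_trans (floor_pow_sum_ge j).
rewrite -ler_pdivrMr ?kappa_gt0// (le_trans (ltW (truncnS_gt _)))//.
apply: (@le_trans _ _ j.+1%:R); first by rewrite ler_nat ltnS.
by rewrite -natrX ler_nat expnS expn1 leq_pmulr.
Qed.

(** Rounding gives |n_(j+1) - w n_j| <= w, and the correction for the quotients c is linear in j, so
    x_(j+1) - w x_j is at most K (j + 1), negligible against x_j >= (j + 1)^2 kappa. *)
Lemma floor_pow_sum_ratio : ratio_tends_to w x.
Proof.
have w45 := w_gt; move=> e e0; pose K := w * A + (w + 2) * `|B - A|.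
exists (Num.truncn (K / (e * kappa))) => j Jj.
apply: (@le_trans _ _ (e * (j.+1%:R ^+ 2 * kappa))); last first.
  by rewrite ler_wpM2l ?floor_pow_sum_ge// ltW.
have jK : K <= e * kappa * j.+1%:R.
  rewrite mulrC -ler_pdivrMr ?mulr_gt0// (le_trans (ltW (truncnS_gt _)))//.
  by rewrite ler_nat ltnS.
apply: (@le_trans _ _ (K * j.+1%:R)); last first.
  have -> : e * (j.+1%:R ^+ 2 * kappa) = e * kappa * j.+1%:R * j.+1%:R by ring.
  by rewrite ler_wpM2r.
rewrite !floor_pow_sumE.
have -> : (floor_pow j.+1)%:R * A + j.+2%:R * (B - A) -
    w * ((floor_pow j)%:R * A + j.+1%:R * (B - A)) =
    ((floor_pow j.+1)%:R - w * (floor_pow j)%:R) * A +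
    (j.+2%:R - w * j.+1%:R) * (B - A) by ring.
have j1 : 1 <= j.+1%:R :> R by rewrite ler1n.
apply: (le_trans (ler_normD _ _)); rewrite /K [leRHS]mulrDl lerD//.
  rewrite normrM (gtr0_norm A0) mulrAC ler_wpM2r ?(ltW A0)//.
  apply: (@le_trans _ _ w); last by rewrite ler_peMr//; lra.
  have /andP[a1 a2] := floor_pow_itv j; have /andP[b1 b2] := floor_pow_itv j.+1.
  rewrite exprS in b1 b2; rewrite ler_norml.
  have : w * (floor_pow j)%:R <= w * w ^+ j by rewrite ler_wpM2l//; lra.
  have : w * w ^+ j <= w * ((floor_pow j)%:R + 1) by rewrite ler_wpM2l ?ltW//; lra.
  by move=> ? ?; apply/andP; split; lra.
rewrite normrM mulrAC ler_wpM2r//.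
have wj : w <= w * j.+1%:R by rewrite ler_peMr//; lra.
have wj' : 0 <= w * j.+1%:R by lra.
by rewrite -natr1 ler_norml; apply/andP; split; lra.
Qed.

End FloorPowers.

(** * Minimal polynomials and heights *)

Section GaussLemma.
Variable F : finFieldType.
Implicit Types (d e : {poly F}) (P S : {poly {poly F}}).

Lemma irredp_dvdM d f g : irreducible_poly d -> d %| f * g -> (d %| f) || (d %| g).
Proof.
move=> irr_d dfg; have [//|ndf] := boolP (d %| f).
suff cop : coprimep d f by rewrite -(Gauss_dvdpr _ cop).
have [szd dP] := irr_d; apply: contraNT ndf.
rewrite /coprimep => /dP/(_ (dvdp_gcdl _ _)) gd.
by rewrite -(eqp_dvdl _ gd) dvdp_gcdr.
Qed.

Lemma gauss_prime d P S : irreducible_poly d -> (forall i, d %| (P * S)`_i) ->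
  (forall i, d %| P`_i) \/ (forall i, d %| S`_i).
Proof.
move=> irr_d dPS; apply: contrapT => /not_orP[/existsNP[i0 /negP i0P] /existsNP[j0 /negP j0S]].
have exP : exists i, ~~ (d %| P`_i) by exists i0.
have exS : exists j, ~~ (d %| S`_j) by exists j0.
case: (ex_minnP exP) => i iP imin; case: (ex_minnP exS) => j jS jmin.
have := dPS (i + j)%N; rewrite coefM.
have ij : (i < (i + j).+1)%N by rewrite ltnS leq_addr.
rewrite (bigD1 (Ordinal ij))//= addKn dvdp_addl.
  by move/(irredp_dvdM irr_d); rewrite (negbTE iP) (negbTE jS).
apply: (big_ind (fun x : {poly F} => d %| x)) => [|x y dx dy|k]; first exact: dvdp0.
  by rewrite dvdp_addr.
rewrite -val_eqE /= neq_ltn => /orP[ki|ik].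
  by apply/dvdp_mulr/negPn/negP => /imin; rewrite leqNgt ki.
apply/dvdp_mull/negPn/negP => /jmin; rewrite leqNgt.
by have := ltn_ord k; move: ik => /=; lia.
Qed.

Lemma irredp_factor_ex e : (1 < size e)%N -> exists2 d, irreducible_poly d & d %| e.
Proof.
have [k] := ubnP (size e); elim: k => // k IH in e *; rewrite ltnS => ek e1.
have [irr_e|nirr] := pselect (irreducible_poly e); first by exists e.
have [g [gs ge gne]] : exists g : {poly F}, [/\ size g != 1%N, g %| e & ~~ (g %= e)].
  apply: contrapT => /forallNP nex; apply: nirr; split=> // g gs ge.
  by apply/negPn/negP => gne; apply: (nex g).
have e0 : e != 0 by rewrite -size_poly_gt0 ltnW.
have g0 : g != 0 by apply: contraTneq ge => ->; rewrite dvd0p.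
have g1 : (1 < size g)%N by rewrite ltn_neqAle eq_sym gs size_poly_gt0.
have gek : (size g < k)%N.
  rewrite (leq_trans _ ek)// ltn_neqAle dvdp_leq// andbT.
  by rewrite dvdp_size_eqp.
have [d irr_d dg] := IH g gek g1.
by exists d => //; apply: dvdp_trans ge.
Qed.

Lemma dvdp_coefE d P : d != 0 -> (forall i, d %| P`_i) -> exists S, P = d *: S.
Proof.
move=> d0 dP; exists (\poly_(i < size P) (P`_i %/ d)); apply/polyP => i.
rewrite coefZ coef_poly; case: ltnP => iP; first by rewrite mulrC divpK.
by rewrite nth_default// mulr0.
Qed.

(** Irreducible factors of e are removed one at a time: each divides all coefficients of S, since it
    cannot divide all those of the primitive P0. *)
Lemma gauss_primitive e P S P0 : e != 0 -> primitive P0 -> e *: P = S * P0 ->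
  exists S', P = S' * P0.
Proof.
have [k] := ubnP (size e); elim: k => // k IH in e S *; rewrite ltnS => ek e0 prim eP.
have [e1|e1] := leqP (size e) 1.
  have se : size e == 1%N by rewrite eqn_leq e1 size_poly_gt0.
  have /size_poly1P[x x0 eE] := se.
  exists (x^-1%:P *: S); rewrite -scalerAl -eP scalerA eE -polyCM mulVf//.
  by rewrite scale1r.
have [d irr_d de] := irredp_factor_ex e1; have d0 := irredp_neq0 irr_d.
have dSP i : d %| (S * P0)`_i by rewrite -eP coefZ dvdp_mulr.
have [dS|dP0] := gauss_prime irr_d dSP; last first.
  by have := prim _ dP0; rewrite poly_unitE => /andP[/eqP d1 _]; case: irr_d; rewrite d1.
have [S1 SE] := dvdp_coefE d0 dS.
have eE : e = e %/ d * d by rewrite divpK.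
have ed0 : e %/ d != 0 by apply: contraNneq e0 => ed; rewrite eE ed mul0r.
apply: (IH (e %/ d) S1) => //.
  rewrite (leq_trans _ ek)// [in ltnRHS]eE size_mul//.
  by have [d1 _] := irr_d; case: (size d) d1 => [|[|n]]// _; rewrite !addnS ltnS leq_addr.
apply: (@mulfI _ d%:P); first by rewrite polyC_eq0.
by rewrite !mul_polyC scalerA mulrC -eE eP SE scalerAl.
Qed.

Lemma primitive_part_ex P : P != 0 ->
  exists d, exists P0, [/\ d != 0, primitive P0 & P = d *: P0].
Proof.
have [k] := ubnP (size (lead_coef P)); elim: k => // k IH in P *; rewrite ltnS => Pk P0.
have [pP|] := pselect (primitive P).
  by exists 1, P; rewrite oner_neq0 scale1r.
move=> /existsNP[d /not_implyP[dP dU]].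
have lc0 : lead_coef P != 0 by rewrite lead_coef_eq0.
have d0 : d != 0 by apply: contraTneq (dP (size P).-1) => ->; rewrite dvd0p.
have [S SE] := dvdp_coefE d0 dP.
have S0 : S != 0 by apply: contraNneq P0 => S0; rewrite SE S0 scaler0.
have [|e [P1 [e0 prim PE]]] := IH S _ S0.
  rewrite (leq_trans _ Pk)// SE lead_coefZ size_mul ?lead_coef_eq0//.
  have : (1 < size d)%N.
    rewrite ltn_neqAle size_poly_gt0 d0 andbT eq_sym; apply/negP => /size_poly1P[x x0 dE].
    by apply: dU; rewrite poly_unitE dE size_polyC x0 coefC/= unitfE.
  have : (0 < size (lead_coef S))%N by rewrite size_poly_gt0 lead_coef_eq0.
  by case: (size d) => [|[|m]]//; rewrite !addSn /= => s0 _; rewrite ltnS leq_addl.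
by exists (d * e), P1; rewrite mulf_neq0// -scalerA -PE.
Qed.

End GaussLemma.

(** * Existence of minimal polynomials, and the quadratic case *)

Section MinimalPolynomial.
Variables (F : finFieldType) (L : closedFieldType) (phi : {rmorphism laurent F -> L}).
Local Notation cl := (closure_of_poly phi).
Implicit Types (alpha : L) (P G : {poly {poly F}}).

HB.instance Definition _ := GRing.RMorphism.copy (closure_of_poly phi)
  (phi \o @laurent_of_poly F).

Lemma closure_of_poly_eq0 (f : {poly F}) : (cl f == 0) = (f == 0).
Proof. by rewrite /closure_of_poly fmorph_eq0 laurent_of_poly_eq0. Qed.

Lemma root_scale_closure d P alpha : d != 0 ->
  root (map_poly cl (d *: P)) alpha = root (map_poly cl P) alpha.
Proof. by move=> d0; rewrite map_polyZ rootZ// closure_of_poly_eq0. Qed.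

(* The minimal polynomial is a root polynomial of least degree in X whose
   leading coefficient has least degree in T. *)
Lemma minimal_poly_ex G alpha : G != 0 -> root (map_poly cl G) alpha ->
  is_minimal_poly phi alpha (minimal_poly phi alpha).
Proof.
move=> G0 Ga; apply: (xgetPex 0).
pose good P := P != 0 /\ root (map_poly cl P) alpha.
have ex1 : exists k, `[< exists P, good P /\ size P = k >].
  by exists (size G); apply/asboolP; exists G.
case: (ex_minnP ex1) => k /asboolP[P1 [gP1 sP1]] kmin.
have ex2 : exists l, `[< exists P, [/\ good P, size P = k & size (lead_coef P) = l] >].
  by exists (size (lead_coef P1)); apply/asboolP; exists P1.
case: (ex_minnP ex2) => l /asboolP[P2 [gP2 sP2 lP2]] lmin.
have kle P : good P -> (k <= size P)%N by move=> gP; apply/kmin/asboolP; exists P.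
have lle P : good P -> size P = k -> (l <= size (lead_coef P))%N.
  by move=> gP sP; apply/lmin/asboolP; exists P.
pose u := (lead_coef (lead_coef P2))^-1; pose P := u%:P *: P2.
have u0 : u != 0 by rewrite invr_eq0 !lead_coef_eq0; case: gP2.
have uP0 : u%:P != 0 by rewrite polyC_eq0.
have gP : good P.
  case: gP2 => ? ?; split; last by rewrite root_scale_closure.
  by rewrite -size_poly_gt0 size_scale// size_poly_gt0.
have sP : size P = k by rewrite size_scale.
have lP : size (lead_coef P) = l by rewrite lead_coefZ mul_polyC size_scale.
have [P0 Pa] := gP.
have unit1 (f : {poly F}) : f != 0 -> (size f <= 1)%N -> f \is a GRing.unit.
  move=> f0 f1; have /size_poly1P[x x0 ->] : size f == 1%N.
    by rewrite eqn_leq f1 size_poly_gt0.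
  by rewrite poly_unitE size_polyC x0 coefC/= unitfE.
(* Least degree in X makes the cofactor z constant in X; least degree in T of the leading
   coefficient then makes that constant a unit. Irreducibility and primitivity both follow from
   this. *)
have factor y z : P = y * z -> root (map_poly cl y) alpha -> z \is a GRing.unit.
  move=> PE ya; move: (P0); rewrite PE mulf_eq0 negb_or => /andP[y0 z0].
  have gy : good y by [].
  have szP : size P = (size y + size z).-1 by rewrite PE size_mul.
  have z1 : (0 < size z)%N by rewrite size_poly_gt0.
  have arith (m n : nat) : (0 < n)%N -> ((m + n).-1 <= m)%N -> (0 < m)%N -> (n <= 1)%N.
    by lia.
  have z1' : size z == 1%N.
    rewrite eqn_leq z1 andbT; apply: (arith (size y)) => //; last by rewrite size_poly_gt0.
    by rewrite -szP sP kle.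
  have sy : size y = k by rewrite -sP szP (eqP z1') addn1.
  have lPE : size (lead_coef P) = (size (lead_coef y) + size (lead_coef z)).-1.
    by rewrite PE lead_coefM size_mul ?lead_coef_eq0.
  have lz0 : (0 < size (lead_coef z))%N by rewrite size_poly_gt0 lead_coef_eq0.
  have : (size (lead_coef z) <= 1)%N.
    apply: (arith (size (lead_coef y))) => //; last by rewrite size_poly_gt0 lead_coef_eq0.
    by rewrite -lPE lP lle.
  move=> lz; have zE : lead_coef z = z`_0 by rewrite lead_coefE (eqP z1').
  by rewrite poly_unitE z1' -zE unit1// lead_coef_eq0.
exists P; split => //.
- rewrite ltnNge; apply/negP => /size1_polyC PE.
  move: Pa P0; rewrite PE map_polyC rootC closure_of_poly_eq0 polyC_eq0 => /eqP ->.
  by rewrite eqxx.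
- split => //.
    apply/negP; rewrite poly_unitE => /andP[sP1' _].
    have /size_poly1P[f f0 PE] := sP1'.
    by move: Pa; rewrite PE map_polyC rootC closure_of_poly_eq0 (negbTE f0).
  move=> y z PE; move: Pa; rewrite PE rmorphM rootM => /orP[ya|za].
    by right; apply: factor PE ya.
  by left; apply: (factor z y) za; rewrite mulrC.
- move=> d dP; have d0 : d != 0.
    apply: contraTneq (dP (size P).-1) => ->.
    by rewrite dvd0p -lead_coefE lead_coef_eq0.
  have [S SE] := dvdp_coefE d0 dP.
  have := factor d%:P S; rewrite mul_polyC => /(_ SE) _.
  have Sa : root (map_poly cl S) alpha by rewrite -(root_scale_closure _ _ d0) -SE.
  have := factor S d%:P; rewrite mulrC mul_polyC => /(_ SE Sa).
  by rewrite poly_unitE size_polyC d0 coefC.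
- by rewrite lead_coefZ mul_polyC monicE lead_coefZ /u mulVf// !lead_coef_eq0; case: gP2.
Qed.

Definition closure_irrational alpha := forall r s : {poly F},
  (r != 0) || (s != 0) -> cl r * alpha + cl s != 0.

(** Lets the height of alpha be bounded by that of an explicit quadratic G, which may be neither
    primitive nor normalised. As alpha has no relation of degree one, the pseudo-remainder of P by
    the primitive part of G vanishes; Gauss's lemma and the irreducibility of P finish. *)
Lemma minimal_poly_quadratic G alpha P : closure_irrational alpha ->
  size G = 3%N -> root (map_poly cl G) alpha -> is_minimal_poly phi alpha P ->
  exists d, exists2 u : F, u != 0 & G = d *: (u%:P *: P).
Proof.
move=> irr sG Ga [P1 [P0 _ irrP] primP Pa monP].
have G0 : G != 0 by rewrite -size_poly_gt0 sG.
have [d [G1 [d0 prim GE]]] := primitive_part_ex G0.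
have sG1 : size G1 = 3%N by rewrite -sG GE size_scale.
have G1a : root (map_poly cl G1) alpha by rewrite -(root_scale_closure _ _ d0) -GE.
have R0 : modp P G1 = 0.
  set S := modp P G1; have sS : (size S < 3)%N.
    by rewrite -sG1 ltn_modp -size_poly_gt0 sG1.
  have Sa : root (map_poly cl S) alpha.
    have := Pdiv.WeakIdomain.divp_eq P G1; rewrite -/S => E.
    have : root (map_poly cl (lead_coef G1 ^+ scalp P G1 *: P)) alpha.
      by rewrite map_polyZ rootE hornerZ (eqP Pa) mulr0.
    by rewrite E rmorphD rmorphM !rootE hornerD hornerM (eqP G1a) mulr0 add0r.
  have SE : S = S`_1 *: 'X + (S`_0)%:P.
    apply/polyP => -[|[|i]]; rewrite coefD coefZ coefX coefC/= ?mulr0 ?mulr1 ?add0r ?addr0//.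
    by rewrite nth_default// -ltnS (leq_trans sS).
  have := irr S`_1 S`_0; have : cl S`_1 * alpha + cl S`_0 = 0.
    have := eqP Sa; rewrite {1}SE rmorphD/= map_polyZ map_polyX map_polyC.
    by rewrite hornerD hornerZ hornerX hornerC.
  move=> ->; rewrite eqxx => h.
  by rewrite SE; case: eqP h => [->|_ /(_ isT)//]; case: eqP => [-> _|_ /(_ isT)//];
     rewrite scale0r addr0.
have := Pdiv.WeakIdomain.divp_eq P G1; rewrite R0 addr0 => E.
have [|S SE] := gauss_primitive _ prim E.
  by rewrite expf_neq0// lead_coef_eq0 -size_poly_gt0 sG1.
case: (irrP S G1 SE); rewrite poly_unitE ?sG1//.
move=> /andP[/size_poly1P[f f0 Sf]]; rewrite Sf coefC/= poly_unitE.
move=> /andP[/size_poly1P[u u0 fu] _].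
exists d, u^-1; first by rewrite invr_eq0.
rewrite GE; congr (_ *: _).
by rewrite SE Sf fu mul_polyC scalerA -polyCM mulVf// scale1r.
Qed.

End MinimalPolynomial.

(** * Minima of sets of reals, and finiteness of polynomials of bounded height *)

Lemma minimum_mem_or0 (R : realType) (A : set R) : minimum A = 0 \/ A (minimum A).
Proof. by rewrite /minimum; case: xgetP => [y _ [] |]; [right|left]. Qed.

Lemma finite_minimum (R : realType) (A : set R) (x : R) :
  finite_set A -> A x -> A (minimum A) /\ minimum A <= x.
Proof.
move=> /finite_seqP[s AE] Ax; suff [m [Am mmin]] : exists m, A m /\ lbound A m.
  have [|Ay ymin] := @xgetPex _ 0 (A `&` lbound A); first by exists m.
  by split => //; exact: ymin.
have xs : x \in s by move: Ax; rewrite AE.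
have [m ms mmin] : exists2 m, m \in s & forall y, y \in s -> m <= y.
  elim: (s) x xs {AE Ax} => // z t IH x _.
  case: t IH => [|z' t] IH; first by exists z => [|y]; rewrite ?inE// => /eqP ->.
  have [m mt mmin] := IH z' (mem_head _ _).
  case: (leP z m) => zm; [exists z|exists m]; rewrite ?inE ?eqxx//.
  - by move=> y; rewrite inE => /predU1P[->//|/mmin]; apply: le_trans.
  - by move: mt; rewrite inE => ->; rewrite orbT.
  - by move=> y; rewrite inE => /predU1P[->|/mmin//]; apply: ltW.
by exists m; rewrite AE; split => // y; rewrite /= => /mmin.
Qed.

Lemma horner_map_size3 (A B : comNzRingType) (f : {rmorphism A -> B})
    (P : {poly A}) x : (size P <= 3)%N ->
  (map_poly f P).[x] = f P`_2 * x ^+ 2 + f P`_1 * x + f P`_0.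
Proof.
move=> sP; rewrite (horner_coef_wide _ (leq_trans (size_poly _ _) sP)).
by rewrite !big_ord_recl big_ord0 !coef_map /= expr0 expr1 mulr1 addr0; ring.
Qed.

Lemma size3_coef_neq0 (A : nzRingType) (P : {poly A}) : (size P <= 3)%N ->
  P != 0 -> [|| P`_2 != 0, P`_1 != 0 | P`_0 != 0].
Proof.
move=> sP P0; have sP0 : (0 < size P)%N by rewrite size_poly_gt0.
have := P0; rewrite -lead_coef_eq0 lead_coefE.
by case: (size P) sP sP0 => [|[|[|[|n]]]]//= _ _ ->; rewrite ?orbT.
Qed.

Section HeightFinite.
Variables (R : realType) (F : finFieldType).
Local Notation inj := (@laurent_of_poly F).
Implicit Types P : {poly {poly F}}.

Lemma heightP P (H : R) : 0 <= H ->
  reflect (forall i, laurent_abs R (inj P`_i) <= H) (height R P <= H).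
Proof.
move=> H0; apply: (iffP idP) => [PH i|PH]; last by apply: bigmax_le.
have [iP|iP] := ltnP i (size P); last by rewrite nth_default// rmorph0 abs0.
apply: le_trans PH; rewrite /height.
exact: (le_bigmax _ (fun i : 'I_(size P) => laurent_abs R (inj P`_i)) (Ordinal iP)).
Qed.

(** F is finite and a coefficient of degree d has absolute value q^d > d, so degrees in T are below
    H; this crude bound suffices. Finiteness is what makes the minima in the two exponents
    attained. *)
Lemma finite_height_le (n H : nat) :
  finite_set [set P : {poly {poly F}} | (size P <= n)%N /\ height R P <= H%:R].
Proof.
pose g (c : {ffun 'I_n -> {ffun 'I_H.+1 -> F}}) : {poly {poly F}} :=
  \poly_(i < n) \poly_(j < H.+1)
    (if insub i is Some i' then if insub j is Some j' then c i' j' else 0 else 0).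
apply: (@sub_finite_set _ _ (range g)); last by apply: finite_image; exact: finite_finset.
move=> P [sP /(heightP _ (ler0n _ _)) hP].
exists [ffun i : 'I_n => [ffun j : 'I_H.+1 => P`_i`_j]] => //.
apply/polyP => i; rewrite coef_poly; case: ltnP => iP; last first.
  by rewrite nth_default// (leq_trans sP).
apply/polyP => j; rewrite coef_poly insubT; case: ltnP => jH.
  by rewrite insubT !ffunE.
have [->|Pi0] := eqVneq P`_i 0; first by rewrite coef0.
rewrite nth_default//; have := hP i; rewrite abs_poly// -natrX ler_nat => qH.
apply: leq_trans jH.
have := leq_trans (ltn_expl (size P`_i).-1 (finNzRing_gt1 F)) qH.
by case: (size _) => //= k; rewrite ltnS; apply: ltnW.
Qed.

End HeightFinite.

Lemma finite_roots (L : closedFieldType) (p : {poly L}) :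
  p != 0 -> finite_set [set z | root p z].
Proof.
move=> p0; have [r pE] := closed_field_poly_normal p.
apply: (@sub_finite_set _ _ [set` r]); last exact: finite_seq.
by move=> z /=; rewrite pE rootZ ?lead_coef_eq0// root_prod_XsubC.
Qed.

(** * Algebraicity over F(T) expressed by polynomials over F[T] *)

Section AlgebraicOverRatfun.
Variables (F : finFieldType) (L : closedFieldType) (phi : {rmorphism laurent F -> L}).
Local Notation cl := (closure_of_poly phi).
Local Notation clr := (closure_of_ratfun phi).

Lemma closure_of_ratfun_tofrac (f : {poly F}) : clr (FracField.tofrac f) = cl f.
Proof.
rewrite /closure_of_ratfun; set r := repr _.
have d0 : cl (frac r).2 != 0 by rewrite closure_of_poly_eq0 denom_ratioP.
apply: (mulIf d0); rewrite divfK// -[cl f * _]rmorphM; congr (cl _).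
have := FracField.equivf_l (Ratio f 1); rewrite !numden_Ratio ?oner_neq0// mulr1.
by rewrite mulrC /r; unlock FracField.tofrac.
Qed.

Lemma closure_of_ratfun0 : clr 0 = 0.
Proof. by rewrite -tofrac0 closure_of_ratfun_tofrac rmorph0. Qed.

Lemma ratfun_eq0 (r : {fraction {poly F}}) : (frac (repr r)).1 = 0 -> r = 0.
Proof.
move=> n0; rewrite -[r]reprK -tofrac0; unlock FracField.tofrac.
apply/eqmodP; rewrite /= FracField.equivfE n0 !numden_Ratio ?oner_neq0//.
by rewrite mul0r mulr0.
Qed.

(** [closure_of_ratfun] is defined by chosen representatives and has no morphism structure here;
    denominators are therefore cleared coefficient by coefficient, with the product of all of
    them. *)
Lemma algebraic_ratfunP z : algebraicOver clr z <->
  exists2 G : {poly {poly F}}, G != 0 & root (map_poly cl G) z.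
Proof.
split=> [[p p0 pz]|[G G0 Gz]]; last first.
  exists (map_poly (@FracField.tofrac {poly F}) G).
    by rewrite map_poly_eq0_id0 ?tofrac_eq0 ?lead_coef_eq0.
  suff -> : map_poly clr (map_poly (@FracField.tofrac {poly F}) G) = map_poly cl G.
    by [].
  apply/polyP => i; rewrite coef_map_id0 ?closure_of_ratfun0//.
  by rewrite !coef_map closure_of_ratfun_tofrac.
pose num i := (frac (repr p`_i)).1; pose den i := (frac (repr p`_i)).2.
have den0 i : den i != 0 by exact: denom_ratioP.
pose G := \poly_(i < size p) (num i * \prod_(k < size p | k != i :> nat) den k).
have GE i : cl G`_i = cl (\prod_(k < size p) den k) * clr p`_i.
  rewrite coef_poly; case: ltnP => ip.
    rewrite [\prod_(k < size p) den k](bigD1 (Ordinal ip))//= !rmorphM.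
    by rewrite /closure_of_ratfun mulrAC mulrCA mulfV ?closure_of_poly_eq0// mulr1.
  by rewrite nth_default// closure_of_ratfun0 rmorph0 mulr0.
have D0 : cl (\prod_(k < size p) den k) != 0.
  by rewrite closure_of_poly_eq0; apply/prodf_neq0.
have p1 : (0 < size p)%N by rewrite size_poly_gt0.
exists G.
  apply: contraNneq p0 => G0; rewrite -lead_coef_eq0 lead_coefE.
  apply/eqP/ratfun_eq0.
  have := congr1 (fun H : {poly {poly F}} => H`_(size p).-1) G0.
  rewrite coef_poly prednK// leqnn coef0 => /eqP; rewrite mulf_eq0.
  suff /negbTE -> : \prod_(k < size p | k != (size p).-1 :> nat) den k != 0.
    by rewrite orbF => /eqP.
  by apply/prodf_neq0.
have -> : map_poly cl G = cl (\prod_(k < size p) den k) *: map_poly clr p.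
  apply/polyP => i; rewrite coefZ coef_map /= GE coef_map_id0//.
  exact: closure_of_ratfun0.
by rewrite rootZ.
Qed.

End AlgebraicOverRatfun.

(** * Exponents of approximation *)

Section QuadraticLowerBound.
Variables (R : realType) (F : finFieldType) (y : laurent F).
Local Notation abs := (laurent_abs R).
Local Notation inj := (@laurent_of_poly F).
Hypothesis y_le1 : abs y <= 1.
Local Notation ev u v t x := (inj u * x ^+ 2 + inj v * x + inj t).

Lemma abs_quad_near (C H : R) (u v t : {poly F}) z : 1 <= C -> abs (y - z) <= C ->
  0 <= H -> abs (inj u) <= H -> abs (inj v) <= H ->
  abs (ev u v t z) <= Num.max (abs (ev u v t y)) (abs (y - z) * (H * C)).
Proof.
move=> C1 yz H0 uH vH.
have zC : abs z <= C.
  have -> : z = y - (y - z) by ring.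
  by rewrite absB_le// (le_trans y_le1).
have -> : ev u v t z = ev u v t y - (y - z) * (inj u * (y + z) + inj v) by ring.
apply: le_trans (absB _ _ _) _; rewrite ge_max !le_max lexx /= absM ler_wpM2l ?abs_ge0 ?orbT//.
apply: absD_le; last by rewrite (le_trans vH)// ler_peMr.
by rewrite absM ler_pM ?abs_ge0// absD_le// (le_trans y_le1).
Qed.

(** The values of P at alpha and alpha' are bounded by the maximum of |P(y)| and C^2 H Z^-2, with Z
    = Y and Z = X respectively. Were |P(y)| the smaller one in both cases, the norm would be at most
    (C^3 H X / Y)^2 < 1. *)
Lemma quad_approx_lower (C X Y H : R) f0 f1 f2 alpha alpha' (u v t : {poly F}) :
  quad_approx y C X Y f0 f1 f2 alpha alpha' ->
  1 <= C -> 1 <= X -> 1 <= Y -> 1 <= H ->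
  abs (inj u) <= H -> abs (inj v) <= H -> [|| u != 0, v != 0 | t != 0] ->
  C ^+ 3 * H * X < Y ->
  [/\ inj v = - (inj u * (alpha + alpha')), inj t = inj u * (alpha * alpha') &
      C^-1 * X ^+ 2 <= abs (inj u)] \/
  1 <= C ^+ 4 * H * X ^+ 2 * abs (ev u v t y).
Proof.
move=> qa C1 X1 Y1 H1 uH vH uvt lvl.
have [h|h] := qa_dichotomy qa uvt; [by left|right].
have C0 : 0 < C by exact: lt_le_trans C1.
have X0 : 0 < X by exact: lt_le_trans X1.
have Y0 : 0 < Y by exact: lt_le_trans Y1.
have H0 : 0 < H by exact: lt_le_trans H1.
have near z Z : 1 <= Z -> abs (y - z) <= C * Z ^- 2 ->
    abs (ev u v t z) <= Num.max (abs (ev u v t y)) (C ^+ 2 * H * Z ^- 2).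
  move=> Z1 yz; have Z2 : C * Z ^- 2 <= C.
    by rewrite ler_piMr ?(ltW C0)// invf_le1 ?exprn_ege1// exprn_gt0// (lt_le_trans ltr01).
  apply: le_trans (abs_quad_near t C1 (le_trans yz Z2) (ltW H0) uH vH) _.
  rewrite ge_max !le_max lexx /=; apply/orP; right.
  have -> : C ^+ 2 * H * Z ^- 2 = C * Z ^- 2 * (H * C) by ring.
  by rewrite ler_wpM2r// mulr_ge0 ?ltW.
have na := near _ _ Y1 (qa_root_le qa).
have na' := near _ _ X1 (qa_conj_le qa).
move: h na na'; set e := abs (ev u v t y); set ea := abs _; set ea' := abs _ => h na na'.
have e0 : 0 <= e by exact: abs_ge0.
have ea0 : 0 <= ea by exact: abs_ge0.
have X2 : 0 < X ^+ 2 by rewrite exprn_gt0.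
have [eX|eX] := leP (C ^+ 2 * H * X ^- 2) e.
  apply: (@le_trans _ _ (C ^+ 4 * H * X ^+ 2 * (C ^+ 2 * H * X ^- 2))).
    have -> : C ^+ 4 * H * X ^+ 2 * (C ^+ 2 * H * X ^- 2) = C ^+ 6 * H ^+ 2.
      by field; rewrite gt_eqF.
    by rewrite mulr_ege1// exprn_ege1.
  by rewrite ler_wpM2l// !mulr_ge0// ?exprn_ge0// ltW.
rewrite (max_idPr (ltW eX)) in na'.
have h2 : 1 <= C ^+ 4 * H * X ^+ 2 * ea.
  apply: le_trans h _; apply: le_trans (ler_wpM2l _ na') _.
    by rewrite mulr_ge0// exprn_ge0// mulr_ge0// ltW.
  by rewrite le_eqVlt; apply/orP; left; apply/eqP; field; rewrite gt_eqF.
apply: le_trans (h2) _.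
have [eY|eY] := leP (C ^+ 2 * H * Y ^- 2) e.
  rewrite (max_idPl eY) in na.
  by rewrite ler_wpM2l// !mulr_ge0// ?exprn_ge0// ltW.
rewrite (max_idPr (ltW eY)) in na.
have : 1 <= (C ^+ 3 * H * X / Y) ^+ 2.
  have -> : (C ^+ 3 * H * X / Y) ^+ 2 = C ^+ 4 * H * X ^+ 2 * (C ^+ 2 * H * Y ^- 2).
    by field; rewrite gt_eqF.
  apply: le_trans (h2) _; by rewrite ler_wpM2l// !mulr_ge0// ?exprn_ge0// ltW.
rewrite leNgt expr_lt1 ?ltr_pdivrMr ?mul1r ?lvl//.
by rewrite !mulr_ge0 ?invr_ge0 ?exprn_ge0// ltW.
Qed.

Variables (w C : R) (X : nat -> R).
Hypotheses (w_gt : 9 / 2 < w) (w_quad : 0 <= w ^+ 2 - 5 * w + 2).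
Hypotheses (C_ge1 : 1 <= C) (X_ge1 : forall j, 1 <= X j)
  (X_le : forall j, X j <= X j.+1).
Let x j := ln (X j).
Hypotheses (x_ratio : ratio_tends_to w x) (x_infty : tends_to_infty x).
Hypothesis qa_ex : forall j, exists f0 f1 f2 : {poly F},
  exists alpha alpha' : laurent F,
  quad_approx y C (X j) (X j.+1) f0 f1 f2 alpha alpha'.

Let C0 : 0 < C. Proof. exact: lt_le_trans C_ge1. Qed.
Let X0 j : 0 < X j. Proof. exact: lt_le_trans (X_ge1 j). Qed.
Let lnC0 : 0 <= ln C. Proof. exact: ln_ge0. Qed.

(** Shaped to serve both exponents. The first alternative keeps the stronger bound w - 1 and a spare
    ln 2, to pay for the passage from |P(y)| to the distance of a root; the second one names the
    roots and bounds their distances directly. *)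
Lemma quad_value_upper (e : R) : 0 < e -> exists h0 : R, forall H : R,
  1 <= H -> h0 <= ln H -> forall u v t : {poly F},
  abs (inj u) <= H -> abs (inj v) <= H -> [|| u != 0, v != 0 | t != 0] ->
  (0 < abs (ev u v t y) /\
   ln 2 - ln (abs (ev u v t y)) <= (w - 1 + e) * ln H) \/
  exists alpha alpha' : laurent F,
    [/\ inj v = - (inj u * (alpha + alpha')), inj t = inj u * (alpha * alpha'),
        [/\ inj u != 0, 0 < abs (y - alpha) & 0 < abs (y - alpha')],
        - ln (abs (ev u v t y)) <= (w + e) * ln H &
        - ln (abs (y - alpha)) <= (w + e) * ln H /\
        - ln (abs (y - alpha')) <= (w + e) * ln H].
Proof.
(* C^4 is the constant of [quad_approx_lower], and ln 2 is the spare term of the statement. *)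
move=> e0; pose K := 4 * ln C + ln 2.
have ln2 : 0 <= ln 2 :> R by rewrite ln_ge0// ler1n.
have lC := lnC0.
have K0 : 0 <= K by rewrite /K; lra.
have x0 j : 0 <= x j by rewrite ln_ge0.
have [h0 h0P] := choose_level w_gt w_quad K0 x0 x_ratio x_infty e0.
exists h0 => H H1 /h0P[j [lvl b1 b2]] u v t uH vH uvt.
have [f0 [f1 [f2 [alpha [alpha' qa]]]]] := qa_ex j.
have H0 : 0 < H by exact: lt_le_trans H1.
have lvl' : C ^+ 3 * H * X j < X j.+1.
  rewrite -ltr_ln ?posrE ?mulr_gt0 ?exprn_gt0//.
  do 2!rewrite lnM ?posrE ?mulr_gt0 ?exprn_gt0//.
  rewrite lnXn// -/(x j) -/(x j.+1) -mulr_natl.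
  by move: lvl; rewrite /K; lra.
have [[vE tE u1]|] := quad_approx_lower qa C_ge1 (X_ge1 j) (X_ge1 j.+1) H1 uH vH uvt lvl'.
  right; exists alpha, alpha'.
  have u0 : 0 < abs (inj u).
    by rewrite (lt_le_trans _ u1)// mulr_gt0 ?invr_gt0 ?exprn_gt0.
  (* X_j^2 / C <= |u| <= H: this places a multiple in the range where the last property of the level
     applies. *)
  have lnu : 2 * x j <= ln H + ln C.
    have : ln (C^-1 * X j ^+ 2) <= ln H.
      by rewrite ler_ln ?posrE ?mulr_gt0 ?invr_gt0 ?exprn_gt0// (le_trans u1).
    rewrite lnM ?posrE ?invr_gt0 ?exprn_gt0// lnV ?posrE// lnXn// -/(x j) -mulr_natl.
    lra.
  have b3 : K + 2 * x j.+1 <= (w + e) * ln H by apply: b2; rewrite /K; lra.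
  have a1 := qa_root_ge qa; have a2 := qa_conj_ge qa.
  have d1 : 0 < abs (y - alpha).
    by rewrite (lt_le_trans _ a1)// mulr_gt0 ?invr_gt0 ?exprn_gt0.
  have d2 : 0 < abs (y - alpha').
    by rewrite (lt_le_trans _ a2)// mulr_gt0 ?invr_gt0 ?exprn_gt0.
  have lnd (Z d : R) : 0 < Z -> C^-1 * Z ^- 2 <= d -> - ln d <= ln C + 2 * ln Z.
    move=> Z0 Zd; have Z2 : 0 < C^-1 * Z ^- 2 by rewrite mulr_gt0 ?invr_gt0 ?exprn_gt0.
    have : ln (C^-1 * Z ^- 2) <= ln d by rewrite ler_ln ?posrE// (lt_le_trans Z2).
    rewrite lnM ?posrE ?invr_gt0 ?exprn_gt0// !lnV ?posrE ?exprn_gt0// lnXn// -mulr_natl.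
    lra.
  have l1 := lnd _ _ (X0 j.+1) a1; have l2 := lnd _ _ (X0 j) a2.
  rewrite -/(x j.+1) in l1; rewrite -/(x j) in l2.
  have xx : x j <= x j.+1 by rewrite ler_ln ?posrE.
  have K3 : 4 * ln C <= K by rewrite /K; lra.
  split => //; first by rewrite -(abs_gt0 R).
    (* |u| >= X_j^2 / C makes up for |y - alpha'| >= X_j^-2 / C, so only the factor |y - alpha|, of
       order X_(j+1)^-2, counts. *)
    have -> : ev u v t y = inj u * ((y - alpha) * (y - alpha')).
      by rewrite vE tE; ring.
    rewrite !absM !lnM ?posrE ?mulr_gt0//.
    have : ln (C^-1 * X j ^+ 2) <= ln (abs (inj u)).
      by rewrite ler_ln ?posrE ?mulr_gt0 ?invr_gt0 ?exprn_gt0.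
    rewrite lnM ?posrE ?invr_gt0 ?exprn_gt0// lnV ?posrE// lnXn// -/(x j) -mulr_natl.
    lra.
  split; have := x0 j.+1; lra.
move=> h; left; set E := abs _ in h *.
have E0 : 0 < E.
  rewrite lt_def abs_ge0 andbT; apply: contraTneq h => ->.
  by rewrite mulr0 -ltNge ltr01.
split => //.
have : 0 <= ln (C ^+ 4 * H * X j ^+ 2 * E) by rewrite ln_ge0.
do 3!rewrite lnM ?posrE ?mulr_gt0 ?exprn_gt0//.
rewrite (lnXn 4 C0) (lnXn 2 (X0 j)) -/(x j).
rewrite -[ln C *+ 4]mulr_natl -[x j *+ 2]mulr_natl.
by move: b1; rewrite /K; lra.
Qed.

(** H is C X_j^2 rounded up, for a large level j. Then log H is about 2 x_j, while -log of the root
    distance and of the polynomial value are both about 2 x_(j+1). The bound e <= w keeps the factor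
    w - e nonnegative. *)
Lemma quad_value_lower (e : R) (N : nat) : 0 < e -> e <= w ->
  exists2 H : nat, (N <= H)%N /\ 1 < H%:R :> R &
  exists f0 f1 f2 : {poly F}, exists alpha alpha' : laurent F,
  [/\ inj f1 = - (inj f2 * (alpha + alpha')) /\ inj f0 = inj f2 * (alpha * alpha'),
      [/\ abs (inj f0) <= H%:R, abs (inj f1) <= H%:R & abs (inj f2) <= H%:R],
      f2 != 0 /\ (forall r s : {poly F}, (r != 0) || (s != 0) ->
        inj r * alpha + inj s != 0),
      0 < abs (y - alpha) /\ (w - e) * ln H%:R <= - ln (abs (y - alpha)) &
      0 < abs (ev f2 f1 f0 y) /\
      (w - e) * ln H%:R <= - ln (abs (ev f2 f1 f0 y))].
Proof.
move=> e0 ew; have lC := lnC0.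
have ln2 : 0 <= ln 2 :> R by rewrite ln_ge0// ler1n.
(* Three factors C come from the leading coefficient and the two root distances; the 2 comes from
   rounding H up. *)
pose K := 3 * ln C + ln 2; have K0 : 0 <= K by rewrite /K; lra.
have [J1 J1P] := ratio_lower w_gt K0 x_ratio x_infty e0.
have [J2 J2P] := x_infty (ln (N.+1)%:R); pose j := maxn J1 J2.
have lowj := J1P j (leq_maxl _ _); have NX := J2P j (leq_maxr _ _).
have [f0 [f1 [f2 [alpha [alpha' qa]]]]] := qa_ex j.
have CX1 : 1 <= C * X j ^+ 2 by rewrite mulr_ege1// exprn_ege1.
pose H := (Num.truncn (C * X j ^+ 2)).+1.
have HC : C * X j ^+ 2 <= H%:R by rewrite ltW// truncnS_gt.
have CH : H%:R <= 2 * (C * X j ^+ 2).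
  rewrite mulr_natl mulr2n -natr1 lerD// truncn_le//.
  exact: le_trans CX1.
have H0 : 0 < H%:R :> R by rewrite ltr0n.
exists H.
  split.
    have : (N.+1)%:R <= X j by rewrite -ler_ln ?posrE.
    move=> NXj; suff : N.+1%:R <= H%:R :> R by rewrite ler_nat => /ltnW.
    rewrite (le_trans NXj)// (le_trans _ HC)// -[leLHS]mul1r ler_pM//.
      exact: ltW.
    by rewrite expr2 ler_peMr// ltW.
  by rewrite ltr1n ltnS truncn_gt0.
have f20 : 0 < abs (inj f2).
  by rewrite (lt_le_trans _ (qa_f2_ge qa))// mulr_gt0 ?invr_gt0 ?exprn_gt0.
have d1 : 0 < abs (y - alpha).
  by rewrite (lt_le_trans _ (qa_root_ge qa))// mulr_gt0 ?invr_gt0 ?exprn_gt0.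
have d2 : 0 < abs (y - alpha').
  by rewrite (lt_le_trans _ (qa_conj_ge qa))// mulr_gt0 ?invr_gt0 ?exprn_gt0.
have lnH : ln H%:R <= 2 * x j + K.
  have : ln H%:R <= ln (2 * (C * X j ^+ 2)).
    by rewrite ler_ln ?posrE ?mulr_gt0 ?exprn_gt0.
  do 2!rewrite lnM ?posrE ?mulr_gt0 ?exprn_gt0//.
  rewrite lnXn// -/(x j) -mulr_natl /K.
  lra.
have bnd : (w - e) * ln H%:R <= 2 * x j.+1 - K.
  by apply: le_trans lowj; rewrite ler_wpM2l// subr_ge0.
have lnd (Z d : R) : 0 < Z -> 0 < d -> d <= C * Z ^- 2 -> ln d <= ln C - 2 * ln Z.
  move=> Z0 d0 Zd.
  have : ln d <= ln (C * Z ^- 2).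
    by rewrite ler_ln ?posrE ?mulr_gt0 ?invr_gt0 ?exprn_gt0.
  rewrite lnM ?posrE ?invr_gt0 ?exprn_gt0// lnV ?posrE ?exprn_gt0// lnXn//.
  lra.
have l1 := lnd _ _ (X0 j.+1) d1 (qa_root_le qa).
have l2 := lnd _ _ (X0 j) d2 (qa_conj_le qa).
rewrite -/(x j.+1) in l1; rewrite -/(x j) in l2.
exists f0, f1, f2, alpha, alpha'; split.
- by split; [exact: qa_mid qa|exact: qa_const qa].
- split; apply: le_trans HC; [exact: qa_f0_le qa|exact: qa_f1_le qa|exact: qa_f2_le qa].
- split; first by rewrite -laurent_of_poly_eq0 -(abs_gt0 R).
  exact: qa_irrational qa.
- by split => //; apply: le_trans bnd _; move: l1; rewrite /K; lra.
have -> : ev f2 f1 f0 y = inj f2 * ((y - alpha) * (y - alpha')).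
  by rewrite (qa_mid qa) (qa_const qa); ring.
rewrite !absM; split; first by rewrite !mulr_gt0.
rewrite !lnM ?posrE ?mulr_gt0//; apply: le_trans bnd _.
have : ln (abs (inj f2)) <= ln C + 2 * x j.
  have : ln (abs (inj f2)) <= ln (C * X j ^+ 2).
    by rewrite ler_ln ?posrE ?mulr_gt0 ?exprn_gt0//; exact: qa_f2_le qa.
  by rewrite lnM ?posrE ?exprn_gt0// lnXn// -/(x j); lra.
by move: l1 l2; rewrite /K; lra.
Qed.

End QuadraticLowerBound.

(** * From the two estimates to the values of the exponents *)

Section Exponents.
Variables (R : realType) (F : finFieldType) (y : laurent F) (w : R).
Local Notation abs := (laurent_abs R).
Local Notation inj := (@laurent_of_poly F).
Local Notation ev u v t x := (inj u * x ^+ 2 + inj v * x + inj t).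
Hypotheses (w_gt1 : 1 < w) (y_le1 : abs y <= 1).

Hypothesis upper : forall e : R, 0 < e -> exists h0 : R, forall H : R,
  1 <= H -> h0 <= ln H -> forall u v t : {poly F},
  abs (inj u) <= H -> abs (inj v) <= H -> [|| u != 0, v != 0 | t != 0] ->
  (0 < abs (ev u v t y) /\
   ln 2 - ln (abs (ev u v t y)) <= (w - 1 + e) * ln H) \/
  exists alpha alpha' : laurent F,
    [/\ inj v = - (inj u * (alpha + alpha')), inj t = inj u * (alpha * alpha'),
        [/\ inj u != 0, 0 < abs (y - alpha) & 0 < abs (y - alpha')],
        - ln (abs (ev u v t y)) <= (w + e) * ln H &
        - ln (abs (y - alpha)) <= (w + e) * ln H /\
        - ln (abs (y - alpha')) <= (w + e) * ln H].

Hypothesis lower : forall (e : R) (N : nat), 0 < e -> e <= w ->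
  exists2 H : nat, (N <= H)%N /\ 1 < H%:R :> R &
  exists f0 f1 f2 : {poly F}, exists alpha alpha' : laurent F,
  [/\ inj f1 = - (inj f2 * (alpha + alpha')) /\ inj f0 = inj f2 * (alpha * alpha'),
      [/\ abs (inj f0) <= H%:R, abs (inj f1) <= H%:R & abs (inj f2) <= H%:R],
      f2 != 0 /\ (forall r s : {poly F}, (r != 0) || (s != 0) ->
        inj r * alpha + inj s != 0),
      0 < abs (y - alpha) /\ (w - e) * ln H%:R <= - ln (abs (y - alpha)) &
      0 < abs (ev f2 f1 f0 y) /\
      (w - e) * ln H%:R <= - ln (abs (ev f2 f1 f0 y))].

Let large_nat (h0 : R) : exists N, forall H : nat, (N <= H)%N ->
  1 < H%:R :> R /\ h0 <= ln (H%:R : R).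
Proof.
exists (Num.truncn (expR h0)).+2 => H NH; split.
  by rewrite ltr1n (leq_trans _ NH).
have eH : expR h0 <= H%:R.
  by rewrite (le_trans (ltW (truncnS_gt _)))// ler_nat (leq_trans _ NH).
by rewrite -[leLHS](expRK h0) ler_ln ?posrE ?expR_gt0// (lt_le_trans (expR_gt0 h0)).
Qed.

Let min_we (e : R) : 0 < e -> [/\ 0 < Num.min e w, Num.min e w <= w & Num.min e w <= e].
Proof.
by move=> e0; rewrite lt_min e0 (lt_trans ltr01 w_gt1) !ge_min !lexx orbT.
Qed.

Let coef3 (f0 f1 f2 : {poly F}) (H : R) : 0 <= H ->
  abs (inj f0) <= H -> abs (inj f1) <= H -> abs (inj f2) <= H ->
  forall i, abs (inj (Poly [:: f0; f1; f2])`_i) <= H.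
Proof.
by move=> H0 h0 h1 h2 [|[|[|i]]]; rewrite coef_Poly//= nth_nil rmorph0 abs0.
Qed.

Lemma poly_exponent_eq : poly_exponent R 2 y = w%:E.
Proof.
have w1 := w_gt1; apply: limn_esup_eq => [e e0|e N e0].
  have [h0 hP] := upper e0; have [N NP] := large_nat h0; exists N => H /NP[H1 hH].
  have lnH : 0 < ln (H%:R : R) by exact: ln_gt0.
  rewrite ler_pdivrMr// /best_poly; set A := [set _ | _ in _].
  (* The default value 0 of [minimum] is harmless for an upper bound: ln 0 = 0, so the quotient
     would be 0. *)
  have [->|[P [hPH sP Py] <-]] := minimum_mem_or0 A.
    by rewrite ln0// oppr0 mulr_ge0//; [lra|exact: ltW].
  rewrite horner_map_size3// in Py *.
  have P0 : P != 0.
    by apply: contraNneq Py => ->; rewrite !coef0 !rmorph0 !mul0r !addr0.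
  move/(heightP _ (ler0n _ _)) in hPH.
  have [[ev0 h]|[a1 [a2 [_ _ _ h _]]]] :=
    hP _ (ltW H1) hH _ _ _ (hPH 2) (hPH 1) (size3_coef_neq0 sP P0); last exact: h.
  have ln2 : 0 <= ln 2 :> R by rewrite ln_ge0// ler1n.
  by lra.
(* The lower estimate is available only for epsilon at most w, whence the truncation. *)
have [e'0 e'w e'e] := min_we e0.
have [H [NH H1] [f0 [f1 [f2 [alpha [alpha' [_ [b0 b1 b2] [f20 _] _ [ev0 h]]]]]]]] :=
  lower N e'0 e'w.
exists H => //; have lnH : 0 < ln (H%:R : R) by exact: ln_gt0.
rewrite ler_pdivlMr// /best_poly.
set P := Poly [:: f0; f1; f2]; set A := [set _ | _ in _].
have sP : (size P <= 3)%N by exact: size_Poly.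
have finA : finite_set A.
  apply: finite_image; apply: (sub_finite_set _ (finite_height_le R F 3 H)).
  by move=> Q [].
have evP : (map_poly inj P).[y] = ev f2 f1 f0 y.
  by rewrite horner_map_size3// !coef_Poly.
have AP : A (abs (map_poly inj P).[y]).
  exists P => //; split => //; last by rewrite evP -(abs_gt0 R).
  by apply/heightP => //; exact: coef3.
have [[Q [_ _ Q0] QE] le_min] := finite_minimum finA AP.
have min0 : 0 < minimum A by rewrite -QE abs_gt0.
have : ln (minimum A) <= ln (abs (ev f2 f1 f0 y)) by rewrite -evP ler_ln ?posrE// evP.
have : (w - e) * ln H%:R <= (w - Num.min e w) * ln H%:R.
  by rewrite ler_wpM2r ?(ltW lnH)// lerD2l lerN2.
lra.
Qed.

Variables (L : closedFieldType) (phi : {rmorphism laurent F -> L}) (absL : L -> R).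
Hypotheses (habs : absolute_value absL)
  (hext : forall x, absL (phi x) = abs x).
Local Notation cl := (closure_of_poly phi).

Let absL_gt0 z : (0 < absL z) = (z != 0).
Proof.
have [h0 h1 _ _] := habs; rewrite lt_def h0 andbT.
by congr (~~ _); apply/eqP/eqP => /h1.
Qed.

Let min_poly_of alpha : algebraicOver (closure_of_ratfun phi) alpha ->
  is_minimal_poly phi alpha (minimal_poly phi alpha).
Proof. by case/algebraic_ratfunP => G G0 Ga; apply: minimal_poly_ex Ga. Qed.

Let cl_root (P : {poly {poly F}}) alpha : (size P <= 3)%N ->
  root (map_poly cl P) alpha ->
  cl P`_2 * alpha ^+ 2 + cl P`_1 * alpha + cl P`_0 = 0.
Proof. by move=> sP /eqP; rewrite (horner_map_size3 _ _ sP). Qed.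

(** The estimate [upper] is applied to the minimal polynomial of alpha. Division by H in the
    definition of w_2^* turns the bound w + e into w - 1 + e. *)
Let root_dist_upper (e : R) : 0 < e -> exists N, forall H : nat, (N <= H)%N ->
  1 < H%:R :> R /\ forall alpha, alpha != phi y ->
  algebraicOver (closure_of_ratfun phi) alpha ->
  alg_height R phi alpha <= H%:R -> (alg_degree phi alpha <= 2)%N ->
  - ln (absL (phi y - alpha)) <= (w + e) * ln H%:R.
Proof.
move=> e0; have w1 := w_gt1.
have [h0 hP] := upper e0; have [N NP] := large_nat h0; exists N => H /NP[H1 hH].
have lnH : 0 < ln (H%:R : R) by exact: ln_gt0.
split => // alpha ay /min_poly_of[P1 [P0 _ _] _ Pa _].
rewrite /alg_height /alg_degree; set P := minimal_poly phi alpha in P1 P0 Pa *.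
move=> /(heightP _ (ler0n _ _)) hPH sP2.
have sP : (size P <= 3)%N by move: sP2; case: (size P).
have Pa0 := cl_root sP Pa.
have [a1 a2 absLM absLD] := habs.
set D := absL _; have D0 : 0 < D by rewrite absL_gt0 subr_eq0 eq_sym.
have [[ev0 h]|[al [al' [vE tE [u0 d1 d2] _ [h1 h2]]]]] :=
  hP _ (ltW H1) hH _ _ _ (hPH 2) (hPH 1) (size3_coef_neq0 sP P0).
  have ln2 : 0 <= ln 2 :> R by rewrite ln_ge0// ler1n.
  have [D1|D1] := leP 1 D.
    have lD : 0 <= ln D by rewrite ln_ge0.
    have : 0 <= (w + e) * ln H%:R by rewrite mulr_ge0//; [lra|exact: ltW].
    lra.
  set E := abs _ in ev0 h.
  (* From P(alpha) = 0, P(y) = (y - alpha)(2 u y + v - u (y - alpha)). Expanding around y needs only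
     |y| <= 1 and D < 1; the factor 2 appears because [absL] is used through the ordinary triangle
     inequality. *)
  have ED : E <= 2 * (D * H%:R).
    have -> : E = absL ((phi y - alpha) * (phi (2 * inj P`_2 * y + inj P`_1) +
        phi (- inj P`_2) * (phi y - alpha))).
      rewrite /E -hext; congr absL; apply/eqP; rewrite -subr_eq0; apply/eqP.
      rewrite -[RHS]Pa0 /closure_of_poly
        !(rmorph_nat, rmorphXn, rmorphN, rmorphD, rmorphM) /=.
      by ring.
    have -> : 2 * (D * H%:R) = D * (H%:R + H%:R * 1) by ring.
    rewrite absLM ler_wpM2l ?(ltW D0)//; apply: le_trans (absLD _ _) _.
    rewrite absLM !hext absN lerD//.
      rewrite absD_le ?hPH// absM -[leRHS]mulr1 ler_pM ?abs_ge0//.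
      rewrite absM -[leRHS]mul1r ler_pM ?abs_ge0 ?hPH//.
      by rewrite absD_le ?abs1.
    by rewrite ler_pM ?abs_ge0 ?hPH ?(ltW D0) ?(ltW D1).
  have H0 : 0 < H%:R :> R by exact: lt_trans H1.
  have : ln E <= ln (2 * (D * H%:R)) by rewrite ler_ln ?posrE ?mulr_gt0.
  do 2!rewrite lnM ?posrE ?mulr_gt0//.
  lra.
(* P is a multiple of the polynomial of an approximation, so alpha is that approximation or its
   conjugate, and both distances are already bounded. *)
have : phi (inj P`_2) * ((alpha - phi al) * (alpha - phi al')) = 0.
  rewrite -[RHS]Pa0 /closure_of_poly vE tE rmorphN !rmorphM rmorphD.
  by ring.
move/eqP; rewrite !mulf_eq0 fmorph_eq0 (negbTE u0) /= !subr_eq0 /D.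
by case/orP => /eqP ->; rewrite -rmorphB hext.
Qed.

(** The given quadratic is the minimal polynomial times nonzero elements of F[T], which have
    absolute value at least 1; removing them can only lower the height. *)
Let height_le_of_root (f0 f1 f2 : {poly F}) alpha (H : R) : 0 <= H ->
  abs (inj f0) <= H -> abs (inj f1) <= H -> abs (inj f2) <= H -> f2 != 0 ->
  closure_irrational phi alpha ->
  cl f2 * alpha ^+ 2 + cl f1 * alpha + cl f0 = 0 ->
  [/\ algebraicOver (closure_of_ratfun phi) alpha, alg_height R phi alpha <= H &
      (alg_degree phi alpha <= 2)%N].
Proof.
move=> H0 h0 h1 h2 f20 irr fa; pose G := Poly [:: f0; f1; f2].
have sG : size G = 3%N by rewrite (@PolyK _ 0).
have G0 : G != 0 by rewrite -size_poly_gt0 sG.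
have Ga : root (map_poly cl G) alpha.
  by rewrite rootE horner_map_size3 ?sG// !coef_Poly /= fa.
have algG : algebraicOver (closure_of_ratfun phi) alpha.
  by apply/algebraic_ratfunP; exists G.
have [d [u u0 GE]] := minimal_poly_quadratic irr sG Ga (min_poly_of algG).
set P := minimal_poly phi alpha in GE.
have d0 : d != 0 by apply: contraNneq G0 => d0; rewrite GE d0 scale0r.
have up0 : u%:P != 0 :> {poly F} by rewrite polyC_eq0.
split => //.
  apply/heightP => // i; apply: le_trans (coef3 H0 h0 h1 h2 i).
  rewrite -/G -/P GE !coefZ !rmorphM !absM mulrA.
  by rewrite ler_peMl ?abs_ge0// mulr_ege1// abs_poly_ge1.
by rewrite /alg_degree -/P -(size_scale _ up0) -(size_scale _ d0) -GE sG.
Qed.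

Lemma alg_exponent_eq : alg_exponent phi absL 2 y = (w - 1)%:E.
Proof.
have w1 := w_gt1; apply: limn_esup_eq => [e e0|e N e0].
  have [N NP] := root_dist_upper e0; exists N => H /NP[H1 hH].
  have lnH : 0 < ln (H%:R : R) by exact: ln_gt0.
  rewrite ler_pdivrMr// /best_alg; set A := [set _ | _ in _].
  have [->|[alpha [alg_a ht dg ay] <-]] := minimum_mem_or0 A.
    by rewrite mulr0 ln0// oppr0 mulr_ge0//; [lra|exact: ltW].
  have := hH alpha ay alg_a ht dg.
  rewrite lnM ?posrE ?(lt_trans ltr01 H1) ?absL_gt0 ?subr_eq0 1?eq_sym//.
  lra.
have [e'0 e'w e'e] := min_we e0.
have [H [NH H1] [f0 [f1 [f2 [alpha [alpha' [[E1 E0] [b0 b1 b2] [f20 irr] [d0 h] _]]]]]]] :=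
  lower N e'0 e'w.
exists H => //.
have lnH : 0 < ln (H%:R : R) by exact: ln_gt0.
rewrite ler_pdivlMr// /best_alg; set A := [set _ | _ in _].
have root_al : cl f2 * phi alpha ^+ 2 + cl f1 * phi alpha + cl f0 = 0.
  rewrite /closure_of_poly E1 E0 -rmorphXn -!rmorphM -!rmorphD -[RHS](rmorph0 phi).
  by congr (phi _); ring.
have [|alg_a ht dg] := height_le_of_root (ler0n _ H) b0 b1 b2 f20 _ root_al.
  by move=> r s rs; rewrite /closure_of_poly -rmorphM -rmorphD fmorph_eq0 irr.
(* Each competitor is a root of one of the finitely many nonzero polynomials of bounded degree and
   height. *)
have finA : finite_set A.
  apply: finite_image.
  pose T := [set P : {poly {poly F}} | (size P <= 3)%N /\ height R P <= H%:R] `&`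
            [set P | P != 0].
  apply: (@sub_finite_set _ _ (\bigcup_(P in T) [set z | root (map_poly cl P) z])).
    move=> z [alg_z hz dz _]; have [P1 [P0 _ _] _ Pz _] := min_poly_of alg_z.
    exists (minimal_poly phi z) => //; split => //; split => //.
    by move: dz; rewrite /alg_degree; case: (size _).
  apply: bigcup_finite.
    by apply: (sub_finite_set _ (finite_height_le R F 3 H)) => P [].
  move=> P [_ P0]; apply: finite_roots.
  by rewrite map_poly_eq0_id0 ?closure_of_poly_eq0 ?lead_coef_eq0.
have AP : A (absL (phi y - phi alpha)).
  exists (phi alpha) => //; split => //.
  by rewrite -subr_eq0 -rmorphB fmorph_eq0 subr_eq0 eq_sym -subr_eq0 -(abs_gt0 R).
have [[z [_ _ _ zy] zE] le_min] := finite_minimum finA AP.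
have min0 : 0 < minimum A by rewrite -zE absL_gt0 subr_eq0 eq_sym.
rewrite -rmorphB hext in le_min.
have : ln (minimum A) <= ln (abs (y - alpha)) by rewrite ler_ln ?posrE.
have : (w - e) * ln H%:R <= (w - Num.min e w) * ln H%:R.
  by rewrite ler_wpM2r ?(ltW lnH)// lerD2l lerN2.
rewrite lnM ?posrE ?(lt_trans ltr01 H1)//.
lra.
Qed.

End Exponents.

(** * The continued fraction of xi_w and its denominators *)

Section PartialQuotients.
Variables (R : realType) (F : finFieldType) (w : R) (b c : {poly F}).
Hypotheses (w_gt : 9 / 2 < w) (hb : (1 < size b)%N) (hc : (1 < size c)%N).
Local Notation abs := (laurent_abs R).
Local Notation inj := (@laurent_of_poly F).
Local Notation a := (partial_quotient w b c).

Lemma partial_quotient_coef : cf_coef a.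
Proof. by move=> i; rewrite /partial_quotient /=; case: ifP. Qed.

Lemma xi_limit : cf_limit R a (xi_ w b c).
Proof. exact: xgetPex (cf_limit_ex R partial_quotient_coef). Qed.

Definition level_den (j : nat) : R := abs (inj (cf_den a (floor_pow w j).+1)).

Lemma level_den_ge1 j : 1 <= level_den j.
Proof.
apply: le_trans (cf_den_ge R _ partial_quotient_coef).
by rewrite exprn_ege1// ltW// card_gt1.
Qed.

Lemma level_den_le j : level_den j <= level_den j.+1.
Proof.
apply: cf_den_le partial_quotient_coef _.
by rewrite ltnS ltnW// floor_pow_lt.
Qed.

Lemma ln_level_den0 : ln (level_den 0) = ln (abs (inj c)).
Proof.
rewrite /level_den floor_pow0 abs_cf_denS; last exact: partial_quotient_coef.
by rewrite -{1}(floor_pow0 w) partial_quotient_pow//= rmorph1 abs1 mulr1.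
Qed.

Lemma ln_level_denS j : ln (level_den j.+1) = ln (level_den j) +
  (floor_pow w j.+1 - floor_pow w j - 1)%:R * ln (abs (inj b)) + ln (abs (inj c)).
Proof.
have ha := partial_quotient_coef; have gap := floor_powS w_gt j.
set m := floor_pow w j in gap *; set N := floor_pow w j.+1 in gap *.
have b0 : 0 < abs (inj b) by rewrite (lt_trans ltr01)// abs_poly_gt1.
have c0 : 0 < abs (inj c) by rewrite (lt_trans ltr01)// abs_poly_gt1.
have gapE k : (m + k < N)%N ->
    abs (inj (cf_den a (m + k).+1)) = abs (inj b) ^+ k * level_den j.
  elim: k => [|k IH] kN; first by rewrite addn0 mul1r.
  rewrite addnS abs_cf_denS// IH; last by rewrite (leq_trans _ kN)// addnS.
  rewrite (@partial_quotient_gap _ _ w_gt _ b c j) ?exprS ?mulrA//.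
  by rewrite -addnS kN addnS ltnS leq_addr.
have X0 : 0 < level_den j by rewrite (lt_le_trans ltr01)// level_den_ge1.
have NE : N = (m + (N - m - 1)).+1 by lia.
have -> : level_den j.+1 =
    abs (inj c) * (abs (inj b) ^+ (N - m - 1) * level_den j).
  rewrite -gapE; last by lia.
  rewrite /level_den -/N {1}NE abs_cf_denS// -NE.
  by rewrite partial_quotient_pow.
do 2!rewrite lnM ?posrE ?mulr_gt0 ?exprn_gt0//.
by rewrite lnXn// -mulr_natl; ring.
Qed.

Lemma xi_quad_approx (hbc : b <> c) j : exists f0 f1 f2 : {poly F},
  exists alpha alpha' : laurent F,
  quad_approx (xi_ w b c) (cf_const R b c) (level_den j) (level_den j.+1)
    f0 f1 f2 alpha alpha'.
Proof.
have [beta beta_b beta_sq] := golden_unit_ex R hb.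
have m0 : (0 < floor_pow w j)%N by rewrite (leq_trans _ (floor_pow_ge w_gt j)).
do 5!eexists.
apply: (quad_approxP hb hc hbc partial_quotient_coef xi_limit (erefl _)
  beta_b beta_sq m0 (floor_powS w_gt j)).
- exact: partial_quotient_pow.
- exact: partial_quotient_pow.
- by move=> k; exact: partial_quotient_gap.
Qed.

End PartialQuotients.

Lemma cf_const_ge1 (R : realType) (F : finFieldType) (b c : {poly F}) :
  (1 < size b)%N -> (1 < size c)%N -> b <> c -> 1 <= cf_const R b c.
Proof.
move=> hb hc hbc; rewrite mulr_ege1 ?mulr_ege1 ?(ltW (abs_poly_gt1 R _))//.
by rewrite -rmorphB abs_poly_ge1// subr_eq0; apply/eqP.
Qed.

(** (5 + sqrt 17)/2 is the larger root of w^2 - 5 w + 2, and it exceeds 9/2 because sqrt 17 > 4. For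
    p = 2, sqrt 65 > 8 gives w > 17/2, so that w (w - 5) is already nonnegative. *)
Lemma large_weight (R : realType) (p : nat) (w : R) :
  (p <> 2%N -> (5 + Num.sqrt 17) / 2 < w) ->
  (p = 2%N -> (9 + Num.sqrt 65) / 2 < w) ->
  9 / 2 < w /\ 0 <= w ^+ 2 - 5 * w + 2.
Proof.
move=> hw hw2; have [/hw2|/hw] := pselect (p = 2%N).
  have s8 : 8 <= Num.sqrt 65 :> R.
    by rewrite -(@ler_pXn2r _ 2) ?nnegrE ?sqrtr_ge0// sqr_sqrtr//; lra.
  move=> ws; have w8 : 17 / 2 < w by lra.
  split; first by lra.
  have : 0 <= w * (w - 5) by rewrite mulr_ge0//; lra.
  lra.
have s4 : 4 <= Num.sqrt 17 :> R.
  by rewrite -(@ler_pXn2r _ 2) ?nnegrE ?sqrtr_ge0// sqr_sqrtr//; lra.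
have sE : Num.sqrt 17 ^+ 2 = 17 :> R by rewrite sqr_sqrtr.
move: s4 sE; set s := Num.sqrt 17 => s4 sE ws; split; first by lra.
have : 0 <= (2 * w - 5 - s) * (2 * w - 5 + s) by rewrite mulr_ge0//; lra.
lra.
Qed.

Theorem theorem1p1 (R : realType) (p m : nat) (F : finFieldType)
    (hp : prime p) (hm : (0 < m)%N) (hF : #|F| = (p ^ m)%N)
    (L : closedFieldType) (phi : {rmorphism laurent F -> L})
    (hL : forall z : L, algebraicOver phi z)
    (absL : L -> R) (habs : absolute_value absL)
    (hext : forall x : laurent F, absL (phi x) = laurent_abs R x)
    (w : R)
    (hw : p <> 2%N -> (5 + Num.sqrt 17) / 2 < w)
    (hw2 : p = 2%N -> (9 + Num.sqrt 65) / 2 < w)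
    (b c : {poly F}) (hb : (1 < size b)%N) (hc : (1 < size c)%N)
    (hbc : b <> c) :
  alg_exponent phi absL 2 (xi_ w b c) = (w - 1)%:E /\
  poly_exponent R 2 (xi_ w b c) = w%:E.
Proof.
have [w_gt w_quad] := large_weight hw hw2.
have w1 : 1 < w by lra.
have y1 : laurent_abs R (xi_ w b c) <= 1.
  by apply/ltW/(cf_abs_lt1 (partial_quotient_coef w hb hc) (xi_limit w hb hc)).
have C1 := cf_const_ge1 R hb hc hbc.
have X1 := level_den_ge1 w hb hc.
have lb : 0 < ln (laurent_abs R (laurent_of_poly b)) by rewrite ln_gt0// abs_poly_gt1.
have lc : 0 < ln (laurent_abs R (laurent_of_poly c)) by rewrite ln_gt0// abs_poly_gt1.
have x0 := ln_level_den0 w_gt hb hc; have xS := ln_level_denS w_gt hb hc.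
have ratio := floor_pow_sum_ratio w_gt lb lc x0 xS.
have infty := floor_pow_sum_infty w_gt lb lc x0 xS.
have qa := xi_quad_approx w_gt hb hc hbc.
have up := quad_value_upper y1 w_gt w_quad C1 X1 (level_den_le w_gt hb hc) ratio infty qa.
have low := quad_value_lower w_gt C1 X1 ratio infty qa.
split; first exact: (alg_exponent_eq w1 y1 up low habs hext).
exact: (poly_exponent_eq w1 up low).
Qed.
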